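(* Let $\mathcal{G}=\{\mathcal{V},\mathcal{E}\}$ be a finite simple undirected connected graph with $\mathcal{V}=\{1,\dots,n\}$, let $m\ge1$, $\sigma>0$, and let $t\ge 0$ be an integer. If $\mathcal{G}$ is $(t+1)$-connected, then for every $\mathcal{C}\subset\mathcal{V}$ with $|\mathcal{C}|\le t$ the distributed optimization protocol described in the context is $(\mathcal{C},\epsilon)$-affine private with $\epsilon=1/(4\sigma^2\underline{\mu}(\mathcal{L}_{\mathcal{H}}))$, where $\mathcal{H}=\mathcal{V}\setminus\mathcal{C}$, $\mathcal{L}_{\mathcal{H}}$ is the graph Laplacian of the subgraph of $\mathcal{G}$ induced by $\mathcal{H}$, and $\underline{\mu}(\mathcal{L}_{\mathcal{H}})$ is its smallest non-zero eigenvalue.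
   Context: Graph notions. $\mathcal{N}_i$ is the set of neighbors of node $i$. A graph is connected if every two distinct nodes are joined by a path (a single-node graph is connected). A set $S\subset\mathcal{V}$ is a vertex cut of $\mathcal{G}$ if removing the nodes of $S$ and all edges incident to them leaves a graph that is not connected. A graph is $k$-connected if its smallest vertex cut contains $k$ nodes. The incidence matrix $\nabla$ of a graph has rows indexed by nodes and columns by edges, with $\nabla_{i,e}=1$ if $e=\{i,j\}$ and $i<j$, $\nabla_{i,e}=-1$ if $e=\{i,j\}$ and $i>j$, and $0$ otherwise; the graph Laplacian is $\mathcal{L}=\nabla\nabla^T$. Costs. Each agent $i\in\mathcal{V}$ holds a private cost $h_i:\mathbb{R}^m\to\mathbb{R}$, $h_i(x)=h_i^{(na)}(x)+\alpha_i^Tx$, where $\alpha_i\in\mathbb{R}^m$ is its affine coefficient and $h_i^{(na)}$ is the non-affine part. The non-affine parts are fixed (non-random, the same for $\alpha$ and $\alpha'$), so a cost is represented by its affine coefficient. Protocol. First phase: for every ordered pair $(i,j)$ with $\{i,j\}\in\mathcal{E}$, agent $i$ draws $r_{ij}\sim N(0_m,\sigma^2 I_m)$, all draws being mutually independent, and sends $r_{ij}$ to agent $j$. Agent $i$ computes the mask $a_i=\sum_{j\in\mathcal{N}_i}(r_{ji}-r_{ij})\in\mathbb{R}^m$ and the effective cost $\widetilde h_i(x)=h_i(x)+a_i^Tx$, whose affine coefficient is $\widetilde\alpha_i=\alpha_i+a_i$. Second phase: the agents run an arbitrary distributed optimization algorithm on the effective costs. In the worst case this reveals all effective costs to everyone,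 and the view is defined accordingly. View. $\mathrm{View}_{\mathcal{C}}(\alpha)$ is the random variable consisting of the affine coefficients $(\alpha_i)_{i\in\mathcal{C}}$ of the corrupted agents, all values $r_{ij}$ sent or received by corrupted agents (i.e. $r_{ij}$ and $r_{ji}$ for every edge $\{i,j\}$ incident to $\mathcal{C}$), and all effective affine coefficients $(\widetilde\alpha_i)_{i\in\mathcal{V}}$, when the agents' affine coefficients are $\alpha=(\alpha_i)_{i\in\mathcal{V}}$. Privacy. For random variables (identified with their laws $P,Q$), $D_{KL}(P,Q)=\int\log\frac{dP}{dQ}\,dP$ is the Kullback–Leibler divergence (natural logarithm), equal to $+\infty$ if $P\not\ll Q$. The distance is $\mathrm{dist}(\alpha,\alpha')=\sqrt{\sum_{k=1}^m\|\alpha^k-\alpha'^k\|^2}$, where $\alpha^k=[\alpha_1^k,\dots,\alpha_n^k]^T$ is the vector of $k$-th coordinates and $\|\cdot\|$ is the Euclidean norm. For $\epsilon>0$, the protocol is $(\mathcal{C},\epsilon)$-affine private if for all $\alpha,\alpha'\in(\mathbb{R}^m)^n$ with $\alpha_i=\alpha_i'$ for $i\in\mathcal{C}$ and $\sum_{i\in\mathcal{H}}\alpha_i=\sum_{i\in\mathcal{H}}\alpha'_i$ one has $D_{KL}(\mathrm{View}_{\mathcal{C}}(\alpha),\mathrm{View}_{\mathcal{C}}(\alpha'))\le\epsilon\,\mathrm{dist}(\alpha,\alpha')^2$. *)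

(* Defs.v *)
From HB Require Import structures.
From mathcomp Require Import all_boot all_order all_algebra.
From mathcomp Require Import all_classical all_reals all_analysis.
From mathcomp Require Import measurable_realfun.

Set Implicit Arguments.
Unset Strict Implicit.
Unset Printing Implicit Defensive.

Import Order.TTheory GRing.Theory Num.Theory.
Import numFieldNormedType.Exports.

Local Open Scope classical_set_scope.
Local Open Scope ring_scope.

(* A graph on the vertex set 'I_n is given by its adjacency relation; that
   it is symmetric and irreflexive is left as a hypothesis. *)

Definition graph_connected n (adj : rel 'I_n) : Prop :=
  forall x y, x != y -> connect adj x y.

(* The nodes of S are renumbered by enum_val, which is increasing, so the
   induced subgraph keeps the order of the nodes. *)
Definition induced_subgraph n (adj : rel 'I_n) (S : {set 'I_n}) :
    rel 'I_#|S| :=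
  fun x y => adj (enum_val x) (enum_val y).
Arguments induced_subgraph {n} adj S _ _.

(* The graph without nodes is connected, so a vertex cut leaves at least
   two nodes. *)
Definition vertex_cut n (adj : rel 'I_n) (S : {set 'I_n}) : Prop :=
  ~ graph_connected (induced_subgraph adj (~: S)).

(* A graph without vertex cut (a complete graph) is not k-connected. *)
Definition k_connected n (adj : rel 'I_n) (k : nat) : Prop :=
  (exists2 S, vertex_cut adj S & #|S| = k) /\
  (forall S, vertex_cut adj S -> (k <= #|S|)%N).

Definition edge_set n (adj : rel 'I_n) : {set {set 'I_n}} :=
  [set E : {set 'I_n} |
    [exists i, exists j, adj i j && (E == [set i; j]%SET)]]%SET.

Definition incidence_mx (R : realType) n (adj : rel 'I_n) :
    'M[R]_(n, #|edge_set adj|) :=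
  \matrix_(i, k)
    if [exists j : 'I_n, (enum_val k == [set i; j]%SET) && (i < j)%N] then 1
    else if [exists j : 'I_n, (enum_val k == [set i; j]%SET) && (j < i)%N]
    then -1 else 0.

Definition laplacian (R : realType) n (adj : rel 'I_n) : 'M[R]_n :=
  incidence_mx R adj *m (incidence_mx R adj)^T.

Definition smallest_nonzero_eigenvalue (R : realType) n (A : 'M[R]_n)
    (mu : R) : Prop :=
  [/\ eigenvalue A mu, mu != 0 &
      forall nu, eigenvalue A nu -> nu != 0 -> mu <= nu].

(* R^m is m.-tuple R, which carries the product of the Borel sigma-algebras. *)

Definition coord_vec (R : realType) n m (alpha : 'I_n -> m.-tuple R)
    (k : 'I_m) : 'cV[R]_n :=
  \col_i tnth (alpha i) k.

(* The norm `|v| of the library is the supremum norm on matrices. *)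
Definition enorm (R : realType) n (v : 'cV[R]_n) : R :=
  Num.sqrt (\sum_i v i ord0 ^+ 2).

Definition dist (R : realType) n m (alpha alpha' : 'I_n -> m.-tuple R) : R :=
  Num.sqrt (\sum_(k < m) enorm (coord_vec alpha k - coord_vec alpha' k) ^+ 2).

Definition KL (R : realType) d (T : measurableType d) (P Q : probability T R) :
    \bar R :=
  if `[< P `<< Q >] then
    (\int[P]_x lne (Radon_Nikodym (charge_of_finite_measure P) Q x))%E
  else +oo%E.

Section noise.
Context (R : realType) (d : measure_display) (Omega : measurableType d).
Variable P : probability Omega R.

(* N(0_m, sigma^2 I_m) is the m-fold product of N(0, sigma^2), a law
   characterized by its values on boxes; the second parameter of normal_prob
   is the standard deviation. *)
Definition gaussian_vector m (sigma : R) (X : {RV P >-> m.-tuple R}) : Prop :=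
  forall B : 'I_m -> set R, (forall k, measurable (B k)) ->
    distribution P X [set x | forall k, B k (tnth x k)] =
    (\prod_(k < m) normal_prob 0 sigma (B k))%E.

Definition mutually_independent d' (T : measurableType d') (I : finType)
    (D : {set I}) (X : I -> {RV P >-> T}) : Prop :=
  forall (J : {set I}) (B : I -> set T), J \subset D ->
    (forall i, measurable (B i)) ->
    P (\bigcap_(i in [set` J]) (X i @^-1` B i)) =
    (\prod_(i in J) P (X i @^-1` B i))%E.

(* r i j is the draw sent by i to j; it is constrained, and used, only when
   i and j are adjacent. *)
Definition protocol_draws n m (adj : rel 'I_n) (sigma : R)
    (r : 'I_n -> 'I_n -> {RV P >-> m.-tuple R}) : Prop :=
  (forall i j, adj i j -> gaussian_vector sigma (r i j)) /\
  mutually_independent [set p : 'I_n * 'I_n | adj p.1 p.2]%SET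
    (fun p => r p.1 p.2).

End noise.

Section protocol.
Context (R : realType) (d : measure_display) (Omega : measurableType d).
Context (P : probability Omega R) (n m : nat) (adj : rel 'I_n).
Variable r : 'I_n -> 'I_n -> {RV P >-> m.-tuple R}.

Definition mask (i : 'I_n) (w : Omega) : m.-tuple R :=
  [tuple \sum_(j | adj i j) (tnth (r j i w) k - tnth (r i j w) k) | k < m].

(* The cost of agent i is represented by its affine coefficient alpha i. *)
Definition effective (alpha : 'I_n -> m.-tuple R) (i : 'I_n) (w : Omega) :
    m.-tuple R :=
  [tuple tnth (alpha i) k + tnth (mask i w) k | k < m].

Definition incident_pairs (C : {set 'I_n}) : {set 'I_n * 'I_n} :=
  [set p | adj p.1 p.2 && ((p.1 \in C) || (p.2 \in C))]%SET.

Local Notation view_space C :=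
  (#|C|.-tuple (m.-tuple R) * #|incident_pairs C|.-tuple (m.-tuple R) *
   n.-tuple (m.-tuple R))%type.

(* Lists the coefficients held by C, the draws sent or received by C, and all
   the effective coefficients; enum_val enumerates C and incident_pairs C. *)
Definition view_fun (C : {set 'I_n}) (alpha : 'I_n -> m.-tuple R) (w : Omega) :
    view_space C :=
  ([tuple alpha (enum_val k) | k < #|C|],
   [tuple r (enum_val k).1 (enum_val k).2 w | k < #|incident_pairs C|],
   [tuple effective alpha i w | i < n]).

Lemma measurable_effective alpha i : measurable_fun setT (effective alpha i).
Proof.
apply/measurable_fun_tnthP => k.
rewrite (_ : _ \o _ = fun w => tnth (alpha i) k +
    \sum_(j <- index_enum 'I_n)
      (if adj i j then tnth (r j i w) k - tnth (r i j w) k else 0)); last first.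
  by apply/funext => w /=; rewrite !tnth_mktuple big_mkcond.
apply: measurable_funD => //; apply: measurable_sum => j.
case: (adj i j) => //.
by apply: measurable_funB; apply: (measurableT_comp (measurable_tnth _)).
Qed.

Lemma measurable_view C alpha : measurable_fun setT (view_fun C alpha).
Proof.
apply: measurable_fun_pair; first apply: measurable_fun_pair.
- exact: measurable_cst.
- apply/measurable_fun_tnthP => k.
  rewrite (_ : _ \o _ = r (enum_val k).1 (enum_val k).2) //.
  by apply/funext => w /=; rewrite tnth_mktuple.
- apply/measurable_fun_tnthP => i.
  rewrite (_ : _ \o _ = effective alpha i); first exact: measurable_effective.
  by apply/funext => w /=; rewrite tnth_mktuple.
Qed.

HB.instance Definition _ C alpha :=
  isMeasurableFun.Build _ _ _ _ (view_fun C alpha)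
    (@measurable_view C alpha).

Definition view (C : {set 'I_n}) (alpha : 'I_n -> m.-tuple R) :
    {RV P >-> view_space C} :=
  view_fun C alpha.

Definition affine_private (C : {set 'I_n}) (eps : R) : Prop :=
  0 < eps /\
  forall alpha alpha' : 'I_n -> m.-tuple R,
    (forall i, i \in C -> alpha i = alpha' i) ->
    (forall k : 'I_m, \sum_(i in ~: C) tnth (alpha i) k =
                      \sum_(i in ~: C) tnth (alpha' i) k) ->
    (KL (distribution P (view C alpha)) (distribution P (view C alpha'))
      <= (eps * dist alpha alpha' ^+ 2)%:E)%E.

End protocol.

(* Main.v *)
From HB Require Import structures.
Require Import Defs.
From mathcomp Require Import all_boot all_order all_algebra.
From mathcomp Require Import all_classical all_reals all_analysis.
From mathcomp Require Import measurable_realfun.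
From mathcomp Require Import ring lra.

(* Let delta = alpha - alpha' on H and solve L_H u = delta coordinatewise.
   Shifting each draw r_ij between honest agents by s_ij = (u_j - u_i) / 2
   turns the view for alpha into the view for alpha', so the two views are
   the images, under one and the same map, of N(s, sigma^2 I) and
   N(0, sigma^2 I). By data processing their divergence is at most
   |s|^2 / (2 sigma^2) = u^T L_H u / (4 sigma^2), and since u and delta are
   orthogonal to the constants, u^T L_H u <= |delta|^2 / mu, where mu is the
   minimum of the Rayleigh quotient of L_H on the orthogonal of the constants. *)

Set Implicit Arguments.
Unset Strict Implicit.
Unset Printing Implicit Defensive.

Import Order.TTheory GRing.Theory Num.Theory.
Import numFieldNormedType.Exports.

Local Open Scope classical_set_scope.
Local Open Scope ring_scope.

(** * Laplacian and spectral gap *)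

(** The divergence is defined through a Radon-Nikodym derivative of the laws of the views, about
    which nothing explicit is known. Data processing is therefore obtained without conditional
    expectations: the logarithm of that derivative is bounded above by a function whose integral the
    Gaussian density controls. The law of the draws is given only by its values on boxes, so the
    effect of a translation is derived one coordinate at a time. Finally, mu has to be an eigenvalue
    and not only a lower bound, so the minimum of the Rayleigh quotient must be attained.
    Connectivity enters twice: it makes the honest subgraph connected, hence the equation for u
    solvable, and it leaves at least two honest nodes, hence a non-zero eigenvalue. *)

Section laplacian.
Context (R : realType) (n : nat) (adj : rel 'I_n).
Hypotheses (adjC : symmetric adj) (adjxx : irreflexive adj).
Implicit Types u v : 'cV[R]_n.

Let incidence (E : {set 'I_n}) (i : 'I_n) : R :=
  if [exists j : 'I_n, (E == [set i; j]%SET) && (i < j)%N] then 1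
  else if [exists j : 'I_n, (E == [set i; j]%SET) && (j < i)%N]
  then -1 else 0.

Let incidence_edge (a b i : 'I_n) : (a < b)%N ->
  incidence [set a; b]%SET i = (i == a)%:R - (i == b)%:R.
Proof.
move=> ab; rewrite /incidence.
have Nab : (a == b) = false by apply/negbTE; rewrite neq_ltn ab.
have sub (x j : 'I_n) : ([set a; b] == [set x; j])%SET ->
    (x == a) && (j == b) || (x == b) && (j == a).
  move=> /eqP/setP h; have := h a; have := h b.
  rewrite !inE !eqxx orbT /=.
  case/esym/orP => /eqP <-; case/esym/orP => /eqP eqa;
    by rewrite -?eqa ?eqxx ?orbT//; move: Nab; rewrite eqa eqxx.
case: (eqVneq i a) => [->|ia].
  rewrite Nab subr0; case: existsP => // -[]; exists b.
  by rewrite eqxx ab.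
case: (eqVneq i b) => [->|ib].
  case: existsP => [[j /andP[/sub]]|_].
    rewrite eqxx [b == a]eq_sym Nab /= => /eqP -> ba.
    by have := ltn_trans ab ba; rewrite ltnn.
  rewrite sub0r; case: existsP => // -[]; exists a.
  by rewrite finset.setUC eqxx ab.
rewrite subr0.
case: existsP => [[j /andP[/sub]]|_]; first by rewrite (negbTE ia) (negbTE ib).
by case: existsP => [[j /andP[/sub]]|//]; rewrite (negbTE ia) (negbTE ib).
Qed.

(** The column of an edge occurs twice in the product, so its orientation sign cancels; the edges at
    [i] correspond to the neighbors of [i]. *)
Lemma laplacian_mulE v i :
  (laplacian R adj *m v) i ord0 = \sum_(j | adj i j) (v i ord0 - v j ord0).
Proof.
rewrite /laplacian -mulmxA mxE.
pose f (E : {set 'I_n}) :=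
  incidence E i * \sum_j incidence E j * v j ord0.
have fpair (a b : 'I_n) : (a < b)%N ->
    f [set a; b]%SET = ((i == a)%:R - (i == b)%:R) * (v a ord0 - v b ord0).
  move=> ab; rewrite /f incidence_edge//; congr (_ * _).
  under eq_bigr do rewrite incidence_edge// mulrBl.
  have delta c : \sum_j (j == c)%:R * v j ord0 = v c ord0.
    rewrite (bigD1 c)//= eqxx mul1r big1 ?addr0// => j /negbTE ->.
    by rewrite mul0r.
  by rewrite sumrB !delta.
transitivity (\sum_(E in edge_set adj) f E).
  rewrite [RHS]big_enum_val /=; apply: eq_bigr => k _.
  rewrite /f !mxE; congr (_ * _).
  by apply: eq_bigr => j _; rewrite !mxE.
rewrite (bigID (fun E : {set 'I_n} => i \in E)) /= [X in _ + X]big1 ?addr0; last first.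
  move=> E /andP[]; rewrite inE => /existsP[a /existsP[b /andP[ab /eqP->]]].
  rewrite !inE negb_or => /andP[/negbTE ia /negbTE ib].
  case: (ltngtP a b) => [lt|lt|/val_inj e]; last by rewrite e adjxx in ab.
    by rewrite fpair// ia ib subr0 mul0r.
  by rewrite finset.setUC fpair// ia ib subr0 mul0r.
(* The edges containing [i] are the image of its neighbors under [j |-> {i, j}], which is injective
   there because there are no loops. *)
rewrite (eq_bigl (mem ((fun j => [set i; j]%SET) @:
    [set j | adj i j]%SET)%SET)); last first.
  move=> E; apply/andP/imsetP => [[]|[j]].
    rewrite inE => /existsP[a /existsP[b /andP[ab /eqP->]]].
    rewrite !inE => /orP[] /eqP ->; first by exists b => //; rewrite inE.
    by exists a; rewrite ?inE 1?adjC// finset.setUC.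
  rewrite inE => ij ->; rewrite !inE eqxx; split => //.
  by apply/existsP; exists i; apply/existsP; exists j; rewrite ij eqxx.
rewrite big_imset /=; last first.
  move=> j k; rewrite !inE => ij ik /setP/(_ j); rewrite !inE eqxx orbT.
  by case: eqP => [ji|_]; [rewrite ji adjxx in ij|move/esym/eqP].
apply: eq_big => [j|j]; rewrite inE// => ij.
have Nij : (i == j) = false by apply/eqP => e; rewrite e adjxx in ij.
case: (ltngtP i j) => [lt|lt|/val_inj e]; last by rewrite e adjxx in ij.
  by rewrite fpair// eqxx Nij subr0 mul1r.
by rewrite finset.setUC fpair// eqxx Nij sub0r mulN1r opprB.
Qed.

Lemma laplacian_sym : (laplacian R adj)^T = laplacian R adj.
Proof. by rewrite /laplacian trmx_mul trmxK. Qed.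

Lemma laplacianT : (laplacian R adj)^T = laplacian R adj.
Proof. by rewrite /laplacian trmx_mul trmxK. Qed.

(** Adding the double sum to its copy with the endpoints exchanged completes the squares. Each edge
    is then counted in both directions, hence the factor 1/2. *)
Lemma laplacian_energy v :
  \sum_i (laplacian R adj *m v) i ord0 * v i ord0 =
  2^-1 * \sum_i \sum_(j | adj i j) (v i ord0 - v j ord0) ^+ 2.
Proof.
set S := LHS.
have S1 : S = \sum_i \sum_(j | adj i j) (v i ord0 - v j ord0) * v i ord0.
  by apply: eq_bigr => i _; rewrite laplacian_mulE mulr_suml.
have S2 : S = \sum_i \sum_(j | adj i j) (v j ord0 - v i ord0) * v j ord0.
  rewrite S1 (exchange_big_dep predT)//=; apply: eq_bigr => i _.
  by apply: eq_bigl => j; rewrite adjC.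
have SS : S + S = \sum_i \sum_(j | adj i j) (v i ord0 - v j ord0) ^+ 2.
  rewrite {1}S1 S2 -big_split; apply: eq_bigr => i _ /=.
  by rewrite -big_split; apply: eq_bigr => j _ /=; ring.
by rewrite -SS; field.
Qed.

Lemma laplacian_energy_ge0 v :
  0 <= \sum_i (laplacian R adj *m v) i ord0 * v i ord0.
Proof.
rewrite laplacian_energy mulr_ge0 ?invr_ge0//.
by apply: sumr_ge0 => i _; apply: sumr_ge0 => j _; exact: sqr_ge0.
Qed.

Lemma laplacian_dotC u v :
  \sum_i (laplacian R adj *m u) i ord0 * v i ord0 =
  \sum_i (laplacian R adj *m v) i ord0 * u i ord0.
Proof.
have dotE (x y : 'cV[R]_n) : \sum_i x i ord0 * y i ord0 = (x^T *m y) ord0 ord0.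
  by rewrite mxE; apply: eq_bigr => i _; rewrite mxE.
have trE (A : 'M[R]_1) : A ord0 ord0 = A^T ord0 ord0 by rewrite mxE.
rewrite !dotE [RHS]trE !(trmx_mul (laplacian R adj)) !laplacianT.
by rewrite (trmx_mul _ u) (trmx_mul v^T) trmxK laplacianT mulmxA.
Qed.

Lemma laplacian_const (c : R) : laplacian R adj *m const_mx c = 0 :> 'cV_n.
Proof.
by apply/colP => i; rewrite laplacian_mulE [RHS]mxE big1// => j _; rewrite !mxE subrr.
Qed.

Lemma sum_laplacian_mul v : \sum_i (laplacian R adj *m v) i ord0 = 0.
Proof.
transitivity (\sum_i (laplacian R adj *m v) i ord0 * (const_mx 1 : 'cV_n) i ord0).
  by apply: eq_bigr => i _; rewrite [const_mx _ _ _]mxE mulr1.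
rewrite laplacian_dotC laplacian_const big1// => i _.
by rewrite mxE mul0r.
Qed.

Hypothesis conn : graph_connected adj.

Lemma laplacian_energy_eq0 v :
  \sum_i (laplacian R adj *m v) i ord0 * v i ord0 = 0 ->
  forall i j, v i ord0 = v j ord0.
Proof.
rewrite laplacian_energy => /eqP; rewrite mulf_eq0 invr_eq0 pnatr_eq0 /=.
have sge0 i : 0 <= \sum_(j | adj i j) (v i ord0 - v j ord0) ^+ 2.
  by apply: sumr_ge0 => j _; exact: sqr_ge0.
rewrite psumr_eq0// => /allP v0.
have vadj i j : adj i j -> v i ord0 = v j ord0.
  move=> ij; have := v0 i (mem_index_enum _); rewrite psumr_eq0; last first.
    by move=> k _; exact: sqr_ge0.
  move=> /allP/(_ j (mem_index_enum _)); rewrite ij sqrf_eq0 subr_eq0.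
  by move/eqP.
move=> i j; have [->//|ij] := eqVneq i j.
have /connectP[p + ->] := conn ij.
elim: p i {ij} => [//|k p ih] i /= /andP[ik kp].
by rewrite (vadj _ _ ik); exact: ih.
Qed.

Lemma laplacian_energy_gt0 v : \sum_i v i ord0 = 0 -> v != 0 ->
  0 < \sum_i (laplacian R adj *m v) i ord0 * v i ord0.
Proof.
move=> v0 vN0; rewrite lt_def laplacian_energy_ge0 andbT.
apply: contra vN0 => /eqP/laplacian_energy_eq0 vcst.
apply/eqP/colP => i; rewrite mxE.
move: v0; rewrite (eq_bigr (fun=> v i ord0)) => [|j _]; last exact: vcst.
rewrite sumr_const card_ord => /eqP; rewrite mulrn_eq0 => /orP[/eqP n0|/eqP//].
by move: (ltn_ord i); rewrite [X in (_ < X)%N]n0.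
Qed.

Lemma laplacian_solve (b : 'cV[R]_n) : \sum_i b i ord0 = 0 ->
  exists2 u : 'cV[R]_n, \sum_i u i ord0 = 0 & laplacian R adj *m u = b.
Proof.
move=> b0.
(* Adding the all-ones matrix makes the Laplacian invertible without changing
   it on vectors of sum 0. *)
pose M := laplacian R adj + const_mx 1.
have Jmul (u : 'cV[R]_n) i :
    ((const_mx 1 : 'M[R]_n) *m u) i ord0 = \sum_j u j ord0.
  by rewrite mxE; apply: eq_bigr => j _; rewrite mxE mul1r.
(* The Laplacian contributes nothing to the sum of the coordinates, so [M] multiplies this sum by
   [n]; only vectors of sum 0 have an image of sum 0. *)
have sumM (u : 'cV[R]_n) :
    \sum_i (M *m u) i ord0 = (\sum_j u j ord0) *+ n.
  under eq_bigr do rewrite mulmxDl mxE Jmul.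
  by rewrite big_split /= sum_laplacian_mul add0r sumr_const card_ord.
have sum0 (u : 'cV[R]_n) : \sum_i (M *m u) i ord0 = 0 -> \sum_j u j ord0 = 0.
  rewrite sumM => /eqP; rewrite mulrn_eq0 => /orP[|/eqP//].
  move=> /eqP n0; rewrite big1// => i _; exfalso.
  by move: (ltn_ord i); rewrite [X in (_ < X)%N]n0.
have MuE (u : 'cV[R]_n) : \sum_j u j ord0 = 0 -> M *m u = laplacian R adj *m u.
  move=> u0; apply/colP => i; rewrite mulmxDl mxE Jmul u0.
  by rewrite addr0.
have Mt : M^T = M.
  by rewrite /M linearD /= trmx_const laplacianT.
have Mu : M \in unitmx.
  rewrite -row_free_unit -kermx_eq0; apply/rowV0P => v /sub_kermxP vM.
  have Mv : M *m v^T = 0 by rewrite -Mt -trmx_mul vM trmx0.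
  have v0 : \sum_j v^T j ord0 = 0.
    by apply: sum0; rewrite Mv big1// => i _; rewrite mxE.
  apply/eqP; rewrite -trmx_eq0; apply/negP => /negP /(laplacian_energy_gt0 v0).
  by rewrite -MuE// Mv big1 ?ltxx// => i _; rewrite mxE mul0r.
have u0 : \sum_i (invmx M *m b) i ord0 = 0.
  by apply: sum0; rewrite mulKVmx.
by exists (invmx M *m b) => //; rewrite -MuE// mulKVmx.
Qed.

Let dot u v : R := \sum_i u i ord0 * v i ord0.

Let Lform v : R := dot (laplacian R adj *m v) v.

(** The unit sphere of the sum-0 hyperplane is compact, so the continuous form [Lform] attains its
    minimum there; homogeneity extends the inequality to all vectors of sum 0. *)
Let rayleigh_min : (1 < n)%N ->
  exists v0 : 'cV[R]_n, [/\ dot v0 v0 = 1, \sum_i v0 i ord0 = 0 &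
    forall v, \sum_i v i ord0 = 0 -> Lform v0 * dot v v <= Lform v].
Proof.
move=> n1.
have csum (I : Type) (s : seq I) (p : pred I) (f : I -> 'rV[R]_n -> R) :
    (forall i, continuous (f i)) ->
    continuous (fun w => \sum_(i <- s | p i) f i w).
  move=> cf w; elim: s => [|i s ih].
    rewrite (_ : (fun _ => _) = cst 0); first exact: cst_continuous.
    by apply/funext => x; rewrite big_nil.
  rewrite (_ : (fun _ => _) = fun x =>
      (if p i then f i x else 0) + \sum_(j <- s | p j) f j x); last first.
    by apply/funext => x; rewrite big_cons; case: ifP; rewrite ?add0r.
  by apply: continuousD => //; case: (p i); [exact: cf|exact: cst_continuous].
have cX (i : 'I_n) : continuous (fun w : 'rV[R]_n => w ord0 i).
  exact: coord_continuous.
have csqr (f : 'rV[R]_n -> R) : continuous f -> continuous (fun w => f w ^+ 2).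
  by move=> cf w; apply: (@continuous_comp _ _ _ f (fun x : R => x ^+ 2) w (cf w));
    exact: exprn_continuous.
pose Q (w : 'rV[R]_n) := Lform w^T.
have cQ : continuous Q.
  rewrite (_ : Q = fun w =>
      2^-1 * \sum_i \sum_(j | adj i j) (w ord0 i - w ord0 j) ^+ 2); last first.
    apply/funext => w; rewrite /Q /Lform /dot laplacian_energy.
    by under eq_bigr do under eq_bigr do rewrite !mxE.
  move=> w; apply: (@continuousM _ _ (cst 2^-1)); first exact: cst_continuous.
  apply: (csum) => i; apply: (csum) => j {}w.
  apply: (csqr) => {}w.
  by apply: (@continuousB _ R^o); exact: cX.
pose S (w : 'rV[R]_n) := \sum_i w ord0 i.
pose N (w : 'rV[R]_n) := \sum_i w ord0 i ^+ 2.
have cS : continuous S by apply: (csum).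
have cN : continuous N by apply: (csum) => i; apply: (csqr); exact: cX.
pose K : set 'rV[R]_n := [set w | S w = 0 /\ N w = 1]%classic.
have clK : closed K.
  rewrite (_ : K = S @^-1` [set x | x = 0] `&` N @^-1` [set x | x = 1])%classic//.
  apply: closedI; apply: preimage_closed => //; exact: closed_eq.
have dotE (w : 'rV[R]_n) : dot w^T w^T = N w.
  by apply: eq_bigr => i _; rewrite !mxE expr2.
(* The matrix norm is the supremum norm; each squared coordinate is at most [N w = 1]. *)
have bK : bounded_set K.
  exists 1; split; first exact: num_real.
  move=> M M1 w [_ Nw].
  rewrite /Num.Def.normr /= mx_normrE; apply: bigmax_le; first exact: le_trans (ltW M1).
  move=> [i j] _ /=; rewrite (ord1 i); apply: le_trans (ltW M1).
  rewrite -(@ler_pXn2r _ 2)// ?nnegrE// expr1n real_normK ?num_real//.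
  rewrite -Nw /N (bigD1 j)//= lerDl.
  by apply: sumr_ge0 => k _; exact: sqr_ge0.
have scale (v : 'cV[R]_n) : v != 0 -> \sum_i v i ord0 = 0 ->
    exists2 c, 0 < c & K (c *: v^T)%R /\ c ^+ 2 * dot v v = 1.
  move=> vN0 v0.
  have vv : 0 < dot v v.
    rewrite lt_def; apply/andP; split; last first.
      by apply: sumr_ge0 => i _; rewrite -expr2 sqr_ge0.
    apply: contra vN0; rewrite psumr_eq0 => [/allP h|i _]; last first.
      by rewrite -expr2 sqr_ge0.
    apply/eqP/colP => i; rewrite mxE; apply/eqP.
    by have := h i (mem_index_enum _); rewrite mulf_eq0 orbb.
  exists (Num.sqrt (dot v v))^-1; first by rewrite invr_gt0 sqrtr_gt0.
  have c2 : (Num.sqrt (dot v v))^-1 ^+ 2 * dot v v = 1.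
    by rewrite exprVn sqr_sqrtr ?(ltW vv)// mulVf// gt_eqF.
  split=> //; split.
    by rewrite /S; under eq_bigr do rewrite !mxE; rewrite -mulr_sumr v0 mulr0.
  rewrite -c2 /N /dot mulr_sumr; apply: eq_bigr => i _; rewrite !mxE.
  by rewrite exprMn [v i _ ^+ 2]expr2.
have QZ (c : R) (v : 'cV[R]_n) : Q (c *: v^T) = c ^+ 2 * Lform v.
  rewrite /Q /Lform /dot mulr_sumr; apply: eq_bigr => i _.
  by rewrite linearZ /= trmxK -scalemxAr !mxE; ring.
(* Two distinct nodes provide a non-zero vector of sum 0, the difference of their indicators. *)
have K0 : (K !=set0)%classic.
  pose i0 := Ordinal (ltnW n1); pose i1 := Ordinal n1.
  pose v : 'cV[R]_n := \col_i ((i == i0)%:R - (i == i1)%:R).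
  have [||c _ [Kc _]] := scale v; last by exists (c *: v^T).
  - apply/eqP => /colP/(_ i0); rewrite /v !mxE eqxx subr0 => /eqP.
    by rewrite oner_eq0.
  - rewrite /v; under eq_bigr do rewrite mxE.
    have one (k : 'I_n) : \sum_i (i == k)%:R = 1 :> R.
      by rewrite (bigD1 k)//= eqxx big1 ?addr0// => i /negbTE ->.
    by rewrite sumrB !one subrr.
have [w /set_mem[Sw Nw] wmin] := compact_EVT_min K0
  (bounded_closed_compact bK clK) (continuous_subspaceT cQ).
exists w^T; split; first by rewrite dotE.
  by transitivity (S w) => //; apply: eq_bigr => i _; rewrite mxE.
move=> v v0; have [->|vN0] := eqVneq v 0.
  have d0 x : dot x 0 = 0 by rewrite /dot big1// => i _; rewrite [X in _ * X]mxE mulr0.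
  by rewrite {2}/Lform !d0 mulr0.
have [c c0 [Kc c2]] := scale v vN0 v0.
have := wmin _ (mem_set Kc); rewrite QZ => le.
rewrite -(@ler_pM2l _ (c ^+ 2)) ?exprn_gt0//.
by rewrite mulrCA c2 mulr1.
Qed.

(** The minimizer is an eigenvector by a first variation. Conversely, an eigenvector for a non-zero
    eigenvalue is a multiple of its image under the Laplacian, so it has sum 0 and its Rayleigh
    quotient competes in the minimum. *)
Lemma laplacian_spectral_gap : (1 < n)%N ->
  exists mu : R, [/\ smallest_nonzero_eigenvalue (laplacian R adj) mu, 0 < mu &
    forall v, \sum_i v i ord0 = 0 ->
      mu * \sum_i v i ord0 * v i ord0 <=
      \sum_i (laplacian R adj *m v) i ord0 * v i ord0].
Proof.
move=> n1; have [v0 [v01 sv0 vmin]] := rayleigh_min n1.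
set mu := Lform v0 in vmin.
have v0N0 : v0 != 0.
  apply/eqP => e; move: v01; rewrite e /dot big1 => [/eqP|i _].
    by rewrite eq_sym oner_eq0.
  by rewrite mxE mul0r.
have mu0 : 0 < mu by exact: laplacian_energy_gt0.
have dotDl u v w : dot (u + v) w = dot u w + dot v w.
  by rewrite /dot -big_split; apply: eq_bigr => i _; rewrite mxE mulrDl.
have dotZl c u w : dot (c *: u) w = c * dot u w.
  by rewrite /dot mulr_sumr; apply: eq_bigr => i _; rewrite mxE mulrA.
have dotC u w : dot u w = dot w u.
  by apply: eq_bigr => i _; rewrite mulrC.
have dotDr u v w : dot w (u + v) = dot w u + dot w v by rewrite !(dotC w) dotDl.
have dotZr c u w : dot w (c *: u) = c * dot w u by rewrite !(dotC w) dotZl.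
have LC u w : dot (laplacian R adj *m u) w = dot (laplacian R adj *m w) u.
  exact: laplacian_dotC.
(* First variation of the Rayleigh quotient at its minimizer [v0]. *)
have var (w : 'cV[R]_n) : \sum_i w i ord0 = 0 ->
    dot (laplacian R adj *m v0) w = mu * dot v0 w.
  move=> sw.
  pose b := dot (laplacian R adj *m v0) w - mu * dot v0 w.
  pose a := Lform w - mu * dot w w.
  have key (e : R) : 0 <= 2 * e * b + e ^+ 2 * a.
    have := vmin (v0 + e *: w).
    have -> : \sum_i (v0 + e *: w) i ord0 = 0.
      under eq_bigr do rewrite !mxE.
      by rewrite big_split /= -mulr_sumr sv0 sw mulr0 addr0.
    move=> /(_ erefl); rewrite [Lform (v0 + _)]/Lform mulmxDr -scalemxAr.
    rewrite !(dotDl, dotDr, dotZl, dotZr) v01 (dotC w v0) (LC w v0).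
    rewrite -/(Lform v0) -/(Lform w) -/mu /b /a; lra.
  apply/eqP; rewrite -subr_eq0 -/b; apply/eqP.
  have a0 : 0 <= a by rewrite /a subr_ge0; exact: vmin.
  (* The natural choice for the quadratic is [- b / a]; [a + 1] covers [a = 0], and the value is
     still a negative multiple of [b ^+ 2], which forces [b = 0]. *)
  have := key (- b / (a + 1)).
  have a1 : 0 < a + 1 by rewrite ltr_wpDl.
  set x := (a + 1)^-1; have x0 : 0 < x by rewrite invr_gt0.
  have xa : x * a = 1 - x by rewrite /x; field; rewrite gt_eqF.
  have -> : 2 * (- b * x) * b + (- b * x) ^+ 2 * a = b ^+ 2 * (x * (x * a) - 2 * x).
    by ring.
  rewrite xa.
  have -> : x * (1 - x) - 2 * x = - (x + x ^+ 2) by ring.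
  rewrite mulrN oppr_ge0 => le; apply/eqP; rewrite -sqrf_eq0 eq_le sqr_ge0 andbT.
  by move: le; rewrite pmulr_lle0// addr_gt0// exprn_gt0.
have Lv0 : laplacian R adj *m v0 = mu *: v0.
  (* The residual has sum 0, so it is itself an admissible direction; testing it against itself
     gives norm 0. *)
  pose y := laplacian R adj *m v0 - mu *: v0.
  have sy : \sum_i y i ord0 = 0.
    under eq_bigr => i _ do
      rewrite [y _ _]mxE [(- (mu *: v0)) _ _]mxE [(mu *: v0) _ _]mxE.
    by rewrite sumrB sum_laplacian_mul -mulr_sumr sv0 mulr0 subr0.
  have yy : dot y y = 0.
    rewrite {1}/y dotDl -scaleNr dotZl var// mulNr subrr //.
  apply/eqP; rewrite -subr_eq0 -/y; apply/eqP/colP => i; rewrite [RHS]mxE.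
  move: yy => /eqP; rewrite psumr_eq0 => [/allP/(_ i (mem_index_enum _))|j _].
    by rewrite mulf_eq0 orbb => /eqP.
  by rewrite -expr2 sqr_ge0.
exists mu; split=> //; split; last first.
- move=> nu /eigenvalueP[w wL wN0] nuN0.
  have Lw : laplacian R adj *m w^T = nu *: w^T.
    by rewrite -[laplacian R adj]laplacianT -trmx_mul wL linearZ.
  have sw : \sum_i w^T i ord0 = 0.
    have := sum_laplacian_mul w^T; rewrite Lw.
    under eq_bigr do rewrite mxE.
    by rewrite -mulr_sumr => /eqP; rewrite mulf_eq0 (negbTE nuN0) => /eqP.
  have := vmin _ sw; rewrite /Lform Lw dotZl ler_pM2r//.
  rewrite lt_def; apply/andP; split; last first.
    by apply: sumr_ge0 => i _; rewrite -expr2 sqr_ge0.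
  apply: contra wN0; rewrite psumr_eq0 => [/allP h|i _]; last first.
    by rewrite -expr2 sqr_ge0.
  apply/eqP/rowP => i; rewrite mxE; apply/eqP.
  by have := h i (mem_index_enum _); rewrite mulf_eq0 orbb mxE.
- by rewrite gt_eqF.
- apply/eigenvalueP; exists v0^T; last by rewrite trmx_eq0.
  by rewrite -[laplacian R adj]laplacianT -trmx_mul Lv0 linearZ.
Qed.

End laplacian.

(** * Potentials on the induced subgraph *)

Section induced_potential.
Context (R : realType) (n : nat) (adj : rel 'I_n) (H : {set 'I_n}).
Hypotheses (adjC : symmetric adj) (adjxx : irreflexive adj).
Let adjH := induced_subgraph adj H.
Hypothesis conn : graph_connected adjH.

Let adjHC : symmetric adjH. Proof. by move=> a b; exact: adjC. Qed.

Let adjHxx : irreflexive adjH. Proof. by move=> a; exact: adjxx. Qed.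

Lemma induced_potential (mu : R) (delta : 'I_n -> R) : 0 < mu ->
  (forall v : 'cV[R]_#|H|, \sum_i v i ord0 = 0 ->
    mu * \sum_i v i ord0 * v i ord0 <=
    \sum_i (laplacian R adjH *m v) i ord0 * v i ord0) ->
  \sum_(i in H) delta i = 0 ->
  exists U : 'I_n -> R,
    (forall i, i \in H ->
       \sum_(j in H | adj i j) (U i - U j) = delta i) /\
    \sum_(i in H) \sum_(j in H | adj i j) (U i - U j) ^+ 2 <=
      2 * (\sum_(i in H) delta i ^+ 2) / mu.
Proof.
move=> mu0 gap sdelta.
pose b : 'cV[R]_#|H| := \col_a delta (enum_val a).
have sb : \sum_a b a ord0 = 0.
  transitivity (\sum_(i in H) delta i) => //.
  by rewrite [RHS]big_enum_val; apply: eq_bigr => a _; rewrite mxE.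
have [u su Lu] := laplacian_solve adjHC adjHxx conn sb.
(* At most one index contributes, so this extends [u] by 0 outside [H] without membership proofs. *)
pose U i := \sum_(a : 'I_#|H| | enum_val a == i) u a ord0.
have UE a : U (enum_val a) = u a ord0.
  rewrite /U (eq_bigl (pred1 a)) ?big_pred1_eq// => c /=.
  by rewrite (inj_eq enum_val_inj).
have reindex (F : 'I_n -> R) a :
    \sum_(j in H | adj (enum_val a) j) F j = \sum_(c | adjH a c) F (enum_val c).
  by rewrite big_mkcondr [LHS]big_enum_val [RHS]big_mkcond.
exists U; split => [i iH|].
  rewrite -(enum_rankK_in iH iH) reindex.
  transitivity (b (enum_rank_in iH i) ord0); last by rewrite mxE.
  rewrite -Lu (laplacian_mulE adjHC adjHxx).
  by apply: eq_bigr => c _; rewrite !UE.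
rewrite big_enum_val /=.
under eq_bigr do rewrite reindex.
have : \sum_a (laplacian R adjH *m u) a ord0 * u a ord0 <=
    (\sum_a b a ord0 ^+ 2) / mu.
  set e := leLHS.
  (* Young's inequality for the product of [b] and [u] with weight [mu]; the gap bounds the term in
     [u] by half of the energy, which is then absorbed on the left. *)
  have : e <= (\sum_a b a ord0 ^+ 2) / (2 * mu) + e / 2.
    apply: (@le_trans _ _ ((\sum_a b a ord0 ^+ 2) / (2 * mu) +
        (mu * \sum_a u a ord0 * u a ord0) / 2)); last first.
      by rewrite lerD2l ler_pM2r ?invr_gt0//; exact: gap.
    rewrite /e Lu mulr_sumr !mulr_suml -big_split; apply: ler_sum => a _ /=.
    rewrite -subr_ge0.
    have -> : b a ord0 ^+ 2 / (2 * mu) + mu * (u a ord0 * u a ord0) / 2 -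
        b a ord0 * u a ord0 = (b a ord0 - mu * u a ord0) ^+ 2 / (2 * mu).
      by field; rewrite gt_eqF.
    by rewrite divr_ge0 ?sqr_ge0// mulr_ge0// ltW.
  have -> : (\sum_a b a ord0 ^+ 2) / (2 * mu) = (\sum_a b a ord0 ^+ 2) / mu / 2.
    by field; rewrite gt_eqF.
  lra.
rewrite (laplacian_energy adjHC adjHxx) => energy.
have -> : \sum_(i in H) delta i ^+ 2 = \sum_a b a ord0 ^+ 2.
  by rewrite [LHS]big_enum_val; apply: eq_bigr => a _; rewrite mxE.
rewrite (eq_bigr (fun a => \sum_(c | adjH a c) (u a ord0 - u c ord0) ^+ 2)).
  by move: energy; rewrite -mulrA; lra.
by move=> a _; apply: eq_bigr => c _; rewrite !UE.
Qed.

End induced_potential.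

(** * Shifts of Gaussian vectors *)

Section gaussian_shift.
Context (R : realType) (sigma : R).
Hypothesis sigma0 : 0 < sigma.
Local Open Scope ereal_scope.
Local Notation mu := (@lebesgue_measure R).

Lemma lebesgue_measure_shift (c : R) (A : set R) : measurable A ->
  pushforward mu ((fun x => x + c)%R : _ -> measurableTypeR R) A = mu A.
Proof.
move=> mA; apply/esym/lebesgue_measure_unique => //=; first exact: measurable_funD.
move=> mc _ [[a b]] _ <-.
rewrite /pushforward (_ : _ @^-1` _ = [set` `](a - c)%R, (b - c)%R]]); last first.
  by apply/seteqP; split => x /=; rewrite !in_itv/= ltrBlDr lerBrDr.
rewrite !lebesgue_measure_itv/= !lte_fin ltrD2r; case: ifP => // _.
by rewrite -!EFinD; congr EFin; ring.
Qed.

Lemma integral_lebesgue_shift (c : R) (f : R -> \bar R) :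
  measurable_fun [set: R] f -> (forall x, 0 <= f x) ->
  \int[mu]_x f (x + c)%R = \int[mu]_x f x.
Proof.
move=> mf f0.
have mT : measurable_fun setT
    ((fun x => x + c)%R : measurableTypeR R -> measurableTypeR R).
  exact: measurable_funD.
rewrite -(@ge0_integral_pushforward _ _ _ _ _ _ mT mu setT f)//.
by apply: eq_measure_integral => //= A mA _; exact: lebesgue_measure_shift.
Qed.

(** The Radon-Nikodym derivative and [normal_pdf] have the same integral on every measurable set, so
    they agree almost everywhere. *)
Lemma integral_normal_prob (f : R -> \bar R) :
  measurable_fun [set: R] f -> (forall x, 0 <= f x) ->
  \int[normal_prob 0 sigma]_x f x =
  \int[mu]_x (f x * (normal_pdf 0 sigma x)%:E).
Proof.
move=> mf f0.
have dom := normal_prob_dominates (0 : R) sigma.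
rewrite -(Radon_Nikodym_SigmaFinite.change_of_variables dom f0 measurableT mf).
apply: ge0_ae_eq_integral => //=.
- apply: emeasurable_funM => //.
  exact: measurable_int (Radon_Nikodym_SigmaFinite.f_integrable dom).
- apply: emeasurable_funM => //; apply/measurable_EFinP.
  exact: measurable_normal_pdf.
- by move=> x _; rewrite mule_ge0// Radon_Nikodym_SigmaFinite.f_ge0.
- by move=> x _; rewrite mule_ge0// lee_fin normal_pdf_ge0.
apply: ae_eqe_mul2l; apply: integral_ae_eq => //.
- exact: Radon_Nikodym_SigmaFinite.f_integrable.
- by apply/measurable_EFinP; exact: measurable_normal_pdf.
by move=> A _ mA; rewrite -Radon_Nikodym_SigmaFinite.f_integral.
Qed.

(** The likelihood ratio of N(c, sigma^2) to N(0, sigma^2). *)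
Definition gauss_tilt (c x : R) : R :=
  expR (c * x / sigma ^+ 2 - c ^+ 2 / (2 * sigma ^+ 2)).

Lemma measurable_gauss_tilt c : measurable_fun [set: R] (gauss_tilt c).
Proof.
apply: measurableT_comp => //; apply: measurable_funB => //.
by apply: measurable_funM => //; exact: measurable_funM.
Qed.

Lemma normal_prob_shift c (f : R -> \bar R) :
  measurable_fun [set: R] f -> (forall x, 0 <= f x) ->
  \int[normal_prob 0 sigma]_x f (x + c)%R =
  \int[normal_prob 0 sigma]_x ((gauss_tilt c x)%:E * f x).
Proof.
move=> mf f0.
have mg := measurable_gauss_tilt c.
rewrite !integral_normal_prob//; first last.
- apply: (measurableT_comp mf); exact: measurable_funD.
- by move=> x; rewrite mule_ge0// lee_fin expR_ge0.
- by apply: emeasurable_funM => //; exact/measurable_EFinP.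
(* Translating the right-hand side by [c] leaves a pointwise identity between two Gaussian
   densities. *)
rewrite -(@integral_lebesgue_shift c (fun x => _ * f x * _)); first last.
- by move=> x; rewrite !mule_ge0// lee_fin ?expR_ge0 ?normal_pdf_ge0.
- apply: emeasurable_funM; last by apply/measurable_EFinP; exact: measurable_normal_pdf.
  by apply: emeasurable_funM => //; exact/measurable_EFinP.
apply: eq_integral => x _.
rewrite muleAC muleC; congr (_ * _).
rewrite -EFinM !normal_pdfE ?gt_eqF//= /normal_fun /gauss_tilt !subr0; congr EFin.
rewrite mulrCA -expRD; congr (_ * expR _)%R.
by field; rewrite gt_eqF.
Qed.

End gaussian_shift.

(** * Boxes and single coordinates of tuples *)

Section tuple_coordinates.
Context (T : Type) (N : nat).

Definition box (B : 'I_N -> set T) : set (N.-tuple T) :=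
  [set z | forall k, B k (tnth z k)].

(** With a fixed value at [i], this plays the role of the projection forgetting coordinate [i],
    without changing the length of the tuple. *)
Definition set_tnth (i : 'I_N) (x : T) (z : N.-tuple T) : N.-tuple T :=
  [tuple if k == i then x else tnth z k | k < N].

Lemma set_tnthK i x y z : set_tnth i x (set_tnth i y z) = set_tnth i x z.
Proof.
by apply: eq_from_tnth => k; rewrite !tnth_mktuple; case: ifP => // ->.
Qed.

Lemma set_tnth_id i z : set_tnth i (tnth z i) z = z.
Proof.
by apply: eq_from_tnth => k; rewrite !tnth_mktuple; case: eqP => // ->.
Qed.

End tuple_coordinates.

Section measurable_box.
Context d (T : measurableType d) (N : nat).
Implicit Types B : 'I_N -> set T.

Lemma measurable_box B : (forall k, measurable (B k)) -> measurable (box B).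
Proof.
move=> mB; rewrite (_ : box B = \big[setI/setT]_k ((@tnth _ T ^~ k) @^-1` B k)).
  apply: bigsetI_measurable => k _; rewrite -[X in measurable X]setTI.
  exact: measurable_tnth.
rewrite -bigcap_seq; apply/seteqP; split => z /= Bz => [k _|k]; first exact: Bz.
by apply: Bz; rewrite /= mem_index_enum.
Qed.

(** Boxes are stable under intersection and generate the product sigma-algebra: a condition on one
    coordinate is a box whose other sides are full. *)
Lemma measure_box_unique (R : realType)
    (m1 m2 : {measure set (N.-tuple T) -> \bar R}) :
  (m1 setT < +oo)%E ->
  (forall B, (forall k, measurable (B k)) -> m1 (box B) = m2 (box B)) ->
  forall A, measurable A -> m1 A = m2 A.
Proof.
move=> m1oo m12.
pose G : set (set (N.-tuple T)) :=
  [set A | exists2 B, (forall k, measurable (B k)) & A = box B].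
apply: (@measure_unique _ _ _ G (fun=> setT)).
- apply/seteqP; split => A.
    apply: smallest_sub; first exact: smallest_sigma_algebra.
    move=> X; rewrite -bigcup_seq /= => -[k _ [Y mY <-]].
    apply: sub_sigma_algebra.
    exists (fun j => if j == k then Y else setT) => [j|]; first by case: ifP.
    rewrite setTI; apply/seteqP; split => z /=.
      by move=> Yz j; case: eqP => // ->.
    by move=> /(_ k); rewrite eqxx.
  apply: smallest_sub; first exact: sigma_algebra_measurable.
  by move=> _ [B mB ->]; exact: measurable_box.
- move=> _ _ [B mB ->] [C mC ->]; exists (fun k => B k `&` C k) => [k|].
    exact: measurableI.
  by apply/seteqP; split => z /= => [[Bz Cz] k|BC]; [|split => k; have [] := BC k].
- by move=> _; exists (fun=> setT) => //; apply/seteqP; split.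
- by apply/seteqP; split => // z _; exists 0%N.
- by move=> _ [B mB ->]; exact: m12.
- by [].
Qed.

Lemma measurable_set_tnth i d' (U : measurableType d') (f : U -> T)
    (g : U -> N.-tuple T) :
  measurable_fun setT f -> measurable_fun setT g ->
  measurable_fun setT (fun u => set_tnth i (f u) (g u)).
Proof.
move=> mf mg; apply/measurable_fun_tnthP => k.
rewrite (_ : _ \o _ = if k == i then f else fun u => tnth (g u) k).
  by case: ifP => // _; exact: (measurableT_comp (measurable_tnth k)).
by apply/funext => u /=; rewrite tnth_mktuple; case: ifP.
Qed.

End measurable_box.

(** * Translation of a Gaussian vector *)

Section cameron_martin.
Context (R : realType) (sigma : R) (N : nat).
Hypothesis sigma0 : 0 < sigma.
Variable Q : probability (N.-tuple R) R.
Hypothesis Qbox : forall B : 'I_N -> set R, (forall k, measurable (B k)) ->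
  Q (box B) = (\prod_(k < N) normal_prob 0 sigma (B k))%E.
Local Open Scope ereal_scope.

Local Notation zero_at i := (@set_tnth R N i 0%R).

Let mtset0 i : measurable_fun setT (zero_at i).
Proof. by apply: measurable_set_tnth => //; exact: measurable_id. Qed.

(** For fixed [A] both sides are finite measures in [B], so boxes suffice. This independence of one
    coordinate from the others is what opens the way to Tonelli. *)
Lemma coord_independent i (A : set R) (B : set (N.-tuple R)) :
  measurable A -> measurable B ->
  Q ([set z | A (tnth z i)] `&` [set z | B (zero_at i z)]) =
  normal_prob 0 sigma A * Q [set z | B (zero_at i z)].
Proof.
move=> mA mB.
have mAi : measurable [set z : N.-tuple R | A (tnth z i)].
  by rewrite -[X in measurable X]setTI; exact: measurable_tnth.
have NAfin : normal_prob 0 sigma A \is a fin_num by exact: fin_num_measure.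
have NA0 : (0 <= fine (normal_prob 0 sigma A))%R by exact: fine_ge0.
pose m1 := pushforward (mrestr Q mAi) (zero_at i).
pose m2 := mscale (NngNum NA0) (pushforward Q (zero_at i)).
rewrite setIC -[LHS]/(m1 B) -(fineK NAfin) -[RHS]/(m2 (mtset0 i) B).
apply: measure_box_unique => //=.
- rewrite /pushforward /mrestr preimage_setT setTI.
  by apply: le_lt_trans (probability_le1 _ mAi) (ltry _).
move=> C mC; rewrite /m1 /m2 /mscale /pushforward /mrestr /= fineK//.
(* Coordinate [i] of [zero_at i z] is always 0, so the side [C i] only asks whether 0 belongs to it,
   and the freed side [i] can carry [D]. *)
pose BD (D : set R) k := if k == i then [set x | D x /\ C i 0%R] else C k.
have E0 (D : set R) :
    [set z | box C (zero_at i z)] `&` [set z | D (tnth z i)] = box (BD D).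
  apply/seteqP; split => z; rewrite /BD /=.
    move=> [Cz Dz] k; case: eqP => [->|/eqP ki].
      by split => //; have := Cz i; rewrite tnth_mktuple eqxx.
    by have := Cz k; rewrite tnth_mktuple (negbTE ki).
  move=> h; have := h i; rewrite eqxx => -[Dz Ci]; split => // k.
  rewrite tnth_mktuple; case: eqP => [->//|/eqP ki].
  by have := h k; rewrite (negbTE ki).
have mBD (D : set R) : measurable D -> forall k, measurable (BD D k).
  move=> mD k; rewrite /BD; case: ifP => // _; have [Ci|Ci] := pselect (C i 0%R).
    by rewrite (_ : [set _ | _] = D)//; apply/seteqP; split => x //= [].
  by rewrite (_ : [set _ | _] = set0)//; apply/seteqP; split => x //= [].
have QBD (D : set R) : measurable D ->
    Q ([set z | box C (zero_at i z)] `&` [set z | D (tnth z i)]) =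
    normal_prob 0 sigma D *
    (\1_(C i) (0 : R)%R)%:E * \prod_(k < N | k != i) normal_prob 0 sigma (C k).
  move=> mD; rewrite E0 Qbox; last exact: mBD.
  rewrite (bigD1 i)//=; congr (_ * _); last first.
    by apply: eq_bigr => k /negbTE ki; rewrite /BD ki.
  rewrite /BD eqxx indicE; have [Ci|Ci] := pselect (C i 0%R).
    rewrite mem_set// mule1; congr (normal_prob 0 sigma _).
    by apply/seteqP; split => x //= [].
  rewrite memNset// mule0 (_ : [set _ | _] = set0) ?measure0//.
  by apply/seteqP; split => x //= [].
have QT := QBD setT measurableT; rewrite setIT probability_setT mul1e in QT.
rewrite -[X in _ = _ * X]/(Q [set z | box C (zero_at i z)]) QT.
by rewrite [LHS]QBD// muleA.
Qed.

Let zero_rv i : {RV Q >-> N.-tuple R} :=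
  HB.pack (zero_at i) (isMeasurableFun.Build _ _ _ _ _ (mtset0 i)).

(* [normal_prob] lives on [measurableTypeR R], whose display differs from that
   of [R]. *)
Local Notation RT := (measurableTypeR R).

(** By independence, the joint law of a coordinate and the rest agrees with the product measure on
    rectangles, hence everywhere; Tonelli then applies. *)
Lemma integral_coord i (f : RT * N.-tuple R -> \bar R) :
  measurable_fun setT f -> (forall p, 0 <= f p) ->
  \int[Q]_z f (tnth z i, zero_at i z) =
  \int[distribution Q (zero_rv i)]_y \int[normal_prob 0 sigma]_x f (x, y).
Proof.
move=> mf f0.
pose phi (z : N.-tuple R) : RT * N.-tuple R := (tnth z i, zero_at i z).
have mphi : measurable_fun setT phi.
  apply: measurable_fun_pair; first exact: measurable_tnth.
  exact: mtset0.
pose phi_rv : {RV Q >-> (RT * N.-tuple R)%type} :=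
  HB.pack phi (isMeasurableFun.Build _ _ _ _ _ mphi).
rewrite -(fubini_tonelli2 (m1 := normal_prob 0 sigma)
  (m2 := distribution Q (zero_rv i)) f mf f0).
transitivity (\int[distribution Q phi_rv]_p f p).
  by rewrite ge0_integral_distribution.
apply: eq_measure_integral => X mX _; apply/esym.
apply: product_measure_unique => //= A B mA mB.
exact: coord_independent.
Qed.

Lemma integral_coord_shift i c (phi : N.-tuple R -> \bar R) :
  measurable_fun setT phi -> (forall z, 0 <= phi z) ->
  \int[Q]_z phi (set_tnth i (tnth z i + c)%R z) =
  \int[Q]_z ((gauss_tilt sigma c (tnth z i))%:E * phi z).
Proof.
move=> mphi phi0.
have mset (g : R -> R) : measurable_fun setT g ->
    measurable_fun setT (fun p : RT * N.-tuple R => phi (set_tnth i (g p.1) p.2)).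
  move=> mg; apply: (measurableT_comp mphi); apply: measurable_set_tnth => //.
  exact: measurableT_comp.
transitivity (\int[distribution Q (zero_rv i)]_y \int[normal_prob 0 sigma]_x
    phi (set_tnth i (x + c)%R y)).
  rewrite -(@integral_coord i (fun p => phi (set_tnth i (p.1 + c)%R p.2)))//.
    by apply: eq_integral => z _; rewrite /= set_tnthK.
  by apply: (mset (fun x => x + c)%R); exact: measurable_funD.
pose f (p : RT * N.-tuple R) :=
  (gauss_tilt sigma c p.1)%:E * phi (set_tnth i p.1 p.2).
transitivity (\int[distribution Q (zero_rv i)]_y \int[normal_prob 0 sigma]_x f (x, y)).
  apply: eq_integral => y _.
  rewrite (@normal_prob_shift _ _ sigma0 c (fun x => phi (set_tnth i x y)))//.
  apply: (measurableT_comp mphi); apply: measurable_set_tnth => //.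
rewrite -integral_coord; first last.
- by move=> p; rewrite mule_ge0// lee_fin expR_ge0.
- apply: emeasurable_funM; last by apply: (mset id); exact: measurable_id.
  apply/measurable_EFinP; apply: (measurableT_comp (measurable_gauss_tilt sigma c)).
  exact: measurable_fst.
by apply: eq_integral => z _; rewrite /f /= set_tnthK set_tnth_id.
Qed.

Definition translate (s : 'I_N -> R) (z : N.-tuple R) : N.-tuple R :=
  [tuple (tnth z k + s k)%R | k < N].

Lemma measurable_translate s : measurable_fun setT (translate s).
Proof.
apply/measurable_fun_tnthP => k.
rewrite (_ : _ \o _ = fun z => (tnth z k + s k)%R).
  by apply: measurable_funD => //; exact: measurable_tnth.
by apply/funext => z /=; rewrite tnth_mktuple.
Qed.

(** Induction on the coordinates already translated. As [l] has no repetition, the tilt of the head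
    coordinate is unaffected by the translation of the others and can be moved inside the test
    function. *)
Let shift_coords (s : 'I_N -> R) (l : seq 'I_N) (phi : N.-tuple R -> \bar R) :
  uniq l -> measurable_fun setT phi -> (forall z, 0 <= phi z) ->
  \int[Q]_z phi (translate (fun k => if k \in l then s k else 0%R) z) =
  \int[Q]_z ((\prod_(k <- l) gauss_tilt sigma (s k) (tnth z k))%:E * phi z).
Proof.
elim: l phi => [|i l ih] phi /=.
  move=> _ mphi phi0; apply: eq_integral => z _.
  rewrite big_nil mul1e; congr (phi _); apply: eq_from_tnth => k.
  by rewrite tnth_mktuple addr0.
move=> /andP[il ul] mphi phi0.
set sl := fun k => if k \in l then s k else 0%R.
have ml := measurable_translate sl.
transitivity (\int[Q]_z phi (translate sl (set_tnth i (tnth z i + s i)%R z))).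
  apply: eq_integral => z _; congr (phi _); apply: eq_from_tnth => k.
  rewrite !tnth_mktuple inE /sl; have [->|//] := eqVneq k i.
  by rewrite (negbTE il) addr0.
rewrite (@integral_coord_shift i (s i) (fun z => phi (translate sl z)))//; last first.
  exact: measurableT_comp.
pose chi z := (gauss_tilt sigma (s i) (tnth z i))%:E * phi z.
transitivity (\int[Q]_z chi (translate sl z)).
  apply: eq_integral => z _; rewrite /chi tnth_mktuple /sl (negbTE il) addr0.
  by [].
rewrite ih//; first last.
- by move=> z; rewrite mule_ge0// lee_fin expR_ge0.
- apply: emeasurable_funM => //; apply/measurable_EFinP.
  by apply: (measurableT_comp (measurable_gauss_tilt sigma (s i))); exact: measurable_tnth.
apply: eq_integral => z _; rewrite /chi big_cons muleA; congr (_ * _).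
by rewrite -EFinM mulrC.
Qed.

Theorem cameron_martin (s : 'I_N -> R) (phi : N.-tuple R -> \bar R) :
  measurable_fun setT phi -> (forall z, 0 <= phi z) ->
  \int[Q]_z phi (translate s z) =
  \int[Q]_z ((expR ((\sum_k s k * tnth z k) / sigma ^+ 2
     - (\sum_k s k ^+ 2) / (2 * sigma ^+ 2)))%:E * phi z).
Proof.
move=> mphi phi0.
have := shift_coords s (index_enum_uniq 'I_N) mphi phi0.
rewrite (_ : (fun k => if k \in _ then s k else 0%R) = s); last first.
  by apply/funext => k; rewrite mem_index_enum.
move=> ->; apply: eq_integral => z _; congr (EFin _ * _).
by rewrite /gauss_tilt -expR_sum sumrB !mulr_suml.
Qed.

End cameron_martin.

(** * Divergence of images of shifted Gaussian vectors *)

Section integral_inequalities.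
Context d (T : measurableType d) (R : realType).
Local Open Scope ereal_scope.

(** Only measurability is asked of [f], which will be the logarithm of a density whose integrability
    is not known beforehand. *)
Lemma le_integral_integrable (mu : {measure set T -> \bar R}) (f g : T -> \bar R) :
  measurable_fun setT f -> mu.-integrable setT g -> (forall x, f x <= g x) ->
  \int[mu]_x f x <= \int[mu]_x g x.
Proof.
move=> mf ig fg; have mg := measurable_int _ ig.
rewrite integralE [leRHS]integralE; apply: leeB.
  apply: ge0_le_integral => //; [exact: measurable_funepos..|].
  by move=> x _; rewrite !funeposE ge_max !le_max fg lexx orbT.
apply: ge0_le_integral => //; [exact: measurable_funeneg..|].
by move=> x _; rewrite !funenegE ge_max !le_max leeN2 fg lexx orbT.
Qed.

Lemma integral_distribution_measurable d' (T' : measurableType d')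
    (P : probability T R) (X : {RV P >-> T'}) (f : T' -> \bar R) :
  measurable_fun setT f -> \int[distribution P X]_y f y = \int[P]_x f (X x).
Proof.
move=> mf; rewrite integralE [RHS]integralE; congr (_ - _).
  rewrite ge0_integral_distribution//; last exact: measurable_funepos.
  by apply: eq_integral => x _; rewrite /= !funeposE.
rewrite ge0_integral_distribution//; last exact: measurable_funeneg.
by apply: eq_integral => x _; rewrite /= !funenegE.
Qed.

Lemma measurable_lne_comp (f : T -> \bar R) :
  measurable_fun setT f -> (forall x, f x \is a fin_num) ->
  measurable_fun setT (fun x => lne (f x)).
Proof.
move=> mf ff.
have mff : measurable_fun setT (fine \o f) by exact: measurableT_comp.
rewrite (_ : (fun _ => _) = fun x => if (fine (f x) <= 0)%R then -oo
    else (ln (fine (f x)))%:E); last first.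
  by apply/funext => x; rewrite -[in LHS](fineK (ff x)).
apply: measurable_fun_ifT => //; first exact: measurable_fun_ler.
by apply/measurable_EFinP; exact: measurableT_comp.
Qed.

End integral_inequalities.

Section kl_gaussian_shift.
Context (R : realType) (sigma : R) (N : nat).
Hypothesis sigma0 : 0 < sigma.
Variable Q : probability (N.-tuple R) R.
Hypothesis Qbox : forall B : 'I_N -> set R, (forall k, measurable (B k)) ->
  Q (box B) = (\prod_(k < N) normal_prob 0 sigma (B k))%E.
Context d (T : measurableType d) (F : N.-tuple R -> T) (s : 'I_N -> R).
Hypothesis mF : measurable_fun setT F.
Variables P1 P2 : probability T R.
Hypothesis P1E : forall A, measurable A -> P1 A = Q [set z | A (F (translate s z))].
Hypothesis P2E : forall A, measurable A -> P2 A = Q [set z | A (F z)].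

(** [L z - c] is the log-likelihood ratio of N(s, sigma^2 I) to N(0, sigma^2 I), and [c] is the
    divergence between these two laws. *)
Let L (z : N.-tuple R) := (\sum_k s k * tnth z k) / sigma ^+ 2.
Let c := (\sum_k s k ^+ 2) / (2 * sigma ^+ 2).

Let c0 : 0 <= c.
Proof.
apply: divr_ge0; first by apply: sumr_ge0 => k _; exact: sqr_ge0.
by rewrite mulr_ge0// sqr_ge0.
Qed.

Let mL : measurable_fun setT L.
Proof.
apply: measurable_funM => //; apply: measurable_sum => k.
by apply: measurable_funM => //; exact: measurable_tnth.
Qed.

Let L_translate z : L (translate s z) = L z + 2 * c.
Proof.
rewrite /L /c; under eq_bigr do rewrite tnth_mktuple mulrDr -expr2.
by rewrite big_split /=; field; rewrite gt_eqF.
Qed.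

Local Open Scope ereal_scope.

Let cm (phi : N.-tuple R -> \bar R) :
  measurable_fun setT phi -> (forall z, 0 <= phi z) ->
  \int[Q]_z phi (translate s z) = \int[Q]_z ((expR (L z - c))%:E * phi z).
Proof. by move=> mphi phi0; rewrite (cameron_martin sigma0 Qbox). Qed.

(** Under [Q], [L] is a centered Gaussian of variance [2 * c]. Its moment generating function is
    read off from the total mass 1 of the law translated by [la * s]. *)
Let expectation_expRL (la : R) :
  \int[Q]_z (expR (la * L z))%:E = (expR (la ^+ 2 * c))%:E.
Proof.
have := cameron_martin sigma0 Qbox (fun k => la * s k)%R (measurable_cst 1)
  (fun=> lee01).
rewrite integral_cst//= mul1e probability_setT => E.
transitivity ((expR (la ^+ 2 * c))%:E * 1); last by rewrite mule1.
rewrite E -ge0_integralZl//=; last first.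
  apply: emeasurable_funM => //; apply/measurable_EFinP.
  apply: measurableT_comp => //; apply: measurable_funB => //.
  apply: measurable_funM => //; apply: measurable_sum => k.
  by apply: measurable_funM => //; exact: measurable_tnth.
apply: eq_integral => z _; rewrite mule1 -EFinM -expRD; congr (expR _)%:E.
have -> : (\sum_k la * s k * tnth z k = la * \sum_k s k * tnth z k)%R.
  by rewrite mulr_sumr; apply: eq_bigr => k _; rewrite mulrA.
have -> : (\sum_k (la * s k) ^+ 2 = la ^+ 2 * \sum_k s k ^+ 2)%R.
  by rewrite mulr_sumr; apply: eq_bigr => k _; rewrite exprMn.
by rewrite /L /c; field; rewrite gt_eqF.
Qed.

(** [P1 A] is the integral of the Cameron-Martin density over the preimage of [A] by [F], which is
    [Q]-null as soon as [P2 A = 0]. *)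
Lemma shift_dominated : P1 `<< P2.
Proof.
apply/null_content_dominatesP => A mA A0; rewrite P1E//.
have {}A0 : Q [set z | A (F z)] = 0 by rewrite -P2E.
have mFA : measurable [set z | A (F z)].
  by rewrite -[X in measurable X]setTI; exact: mF.
have mFsA : measurable [set z | A (F (translate s z))].
  rewrite -[X in measurable X]setTI.
  exact: (measurableT_comp mF (measurable_translate s)).
transitivity (\int[Q]_z (\1_A (F (translate s z)) : R)%:E).
  rewrite -(setIT [set z | A (F (translate s z))]) -(integral_indic Q measurableT mFsA).
  by apply: eq_integral => z _; rewrite !indicE.
rewrite (cm (phi := fun z => (\1_A (F z))%:E))//; last first.
  apply/measurable_EFinP; exact: (measurableT_comp (measurable_indic mA)).
rewrite (_ : \int[Q]_z _ = \int[Q]_(z in [set z | A (F z)]) (expR (L z - c))%:E).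
  apply: null_set_integral => //; apply: measurable_funTS.
  apply/measurable_EFinP; apply: measurableT_comp => //.
  exact: measurable_funB.
rewrite [RHS]integral_mkcond epatch_indic.
by apply: eq_integral => z _.
Qed.

Let Fs_rv : {RV Q >-> T} := HB.pack (F \o translate s)
  (isMeasurableFun.Build _ _ _ _ _ (measurableT_comp mF (measurable_translate s))).

Let F_rv : {RV Q >-> T} := HB.pack F (isMeasurableFun.Build _ _ _ _ _ mF).

Let f : T -> \bar R := Radon_Nikodym (charge_of_finite_measure P1) P2.

Let f_fin x : f x \is a fin_num.
Proof. exact/Radon_Nikodym_fin_num/shift_dominated. Qed.

Let f_int : P2.-integrable setT f.
Proof. exact/Radon_Nikodym_integrable/shift_dominated. Qed.

Let mf : measurable_fun setT f := measurable_int _ f_int.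

(** The derivative of a charge may take negative values on a null set; the positive part is a
    version that is nonnegative everywhere. *)
Let fp (x : T) : R := Num.max (fine (f x)) 0%R.

Let fp_ge0 x : (0 <= fp x)%R. Proof. by rewrite le_max lexx orbT. Qed.

Let mfp : measurable_fun setT fp.
Proof. by apply: measurable_maxr => //; exact: measurableT_comp. Qed.

Let integral_fp : \int[Q]_z (fp (F z))%:E <= 1.
Proof.
have -> : \int[Q]_z (fp (F z))%:E = \int[P2]_x (fp x)%:E.
  transitivity (\int[distribution Q F_rv]_x (fp x)%:E).
    by rewrite ge0_integral_distribution//; exact/measurable_EFinP.
  by apply: eq_measure_integral => A mA _; exact: esym (P2E mA).
(* The positive part is [f] on [D] and 0 elsewhere, so its integral is [P1 D]; an upper bound by 1
   is enough. *)
pose D : set T := (fun x => 0 <= fine (f x))%R @^-1` [set true].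
have mD : measurable D.
  rewrite -[D]setTI; apply: measurable_fun_ler => //.
  exact: measurableT_comp.
have -> : \int[P2]_x (fp x)%:E = P1 D.
  rewrite -[P1 D]/(charge_of_finite_measure P1 D).
  rewrite (Radon_Nikodym_integral (nu := charge_of_finite_measure P1)
    (mu := P2) shift_dominated mD) [RHS]integral_mkcond.
  apply: eq_integral => x _; rewrite patchE /fp.
  case: ifPn => [/set_mem /= f0|/negP f0]; first by rewrite max_l// fineK.
  rewrite max_r//; apply: ltW; rewrite ltNge; apply/negP => f1.
  by apply: f0; apply/mem_set.
exact: probability_le1.
Qed.

(* With [w = L z + c] the logarithm of the density at [translate s z], we have
   [ln a <= w + a * expR (- w) - 1], which gives the data processing
   inequality, and [L z <= (expR (la * L z) - 1) / la], which avoids the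
   integrability of [L] and loses nothing as [la] tends to 0. *)
Let majorant (la : R) (z : N.-tuple R) : R :=
  (expR (la * L z) / la + fp (F (translate s z)) * expR (- (L z + c)))%R.

Let lne_le_majorant (la : R) z : (0 < la)%R ->
  lne (f (F (translate s z))) <= (majorant la z)%:E + (c - 1 - la^-1)%:E.
Proof.
move=> la0; rewrite -EFinD -(fineK (f_fin _)) /majorant /fp.
set a := fine _; rewrite /= ; case: ifPn => [_|]; first by rewrite leNye.
rewrite -ltNge => a0; rewrite lee_fin max_l ?(ltW a0)//.
have h1 : (L z <= (expR (la * L z) - 1) / la)%R.
  rewrite ler_pdivlMr// mulrC lerBrDl; exact: expR_ge1Dx.
have h2 : (ln a - (L z + c) <= a * expR (- (L z + c)) - 1)%R.
  rewrite -[X in (_ - X)%R]opprK -[X in (_ - - X)%R]expRK opprK -lnM ?posrE ?expR_gt0//.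
  have -> : (a * expR (- (L z + c)) = 1 + (a * expR (- (L z + c)) - 1))%R
    by rewrite addrCA subrr addr0.
  rewrite [leRHS]addrAC subrr add0r; apply: le_ln1Dx.
  by rewrite ltrBrDr addNr mulr_gt0// expR_gt0.
rewrite mulrBl mul1r in h1; lra.
Qed.

Let measurable_majorant la : measurable_fun setT (majorant la).
Proof.
have mFs : measurable_fun setT (fun z => fp (F (translate s z))).
  apply: (measurableT_comp mfp); exact: (measurableT_comp mF (measurable_translate s)).
apply: measurable_funD; apply: measurable_funM => //.
  by apply: measurableT_comp => //; exact: measurable_funM.
apply: measurableT_comp => //; apply: measurableT_comp => //.
exact: measurable_funD.
Qed.

Let majorant_ge0 la z : (0 < la)%R -> (0 <= majorant la z)%R.
Proof.
by move=> la0; rewrite addr_ge0 ?divr_ge0 ?mulr_ge0 ?fp_ge0 ?expR_ge0// ltW.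
Qed.

(** The first term is the moment generating function. In the second, after the translation is
    undone, the exponential cancels the Cameron-Martin density and leaves the integral of [fp], at
    most 1. *)
Let integral_majorant (la : R) : (0 < la)%R ->
  \int[Q]_z (majorant la z)%:E <= (expR (la ^+ 2 * c) / la + 1)%:E.
Proof.
move=> la0.
have mexp : measurable_fun setT (fun z => expR (la * L z)).
  by apply: measurableT_comp => //; exact: measurable_funM.
have mphi : measurable_fun setT (fun z => fp (F z) * expR (- (L z - c)))%R.
  apply: measurable_funM; first exact: measurableT_comp.
  apply: measurableT_comp => //; apply: measurableT_comp => //.
  exact: measurable_funB.
have mphis : measurable_fun setT (fun z => fp (F (translate s z)) * expR (- (L z + c)))%R.
  apply: measurable_funM.
    by apply: (measurableT_comp mfp); exact: (measurableT_comp mF (measurable_translate s)).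
  apply: measurableT_comp => //; apply: measurableT_comp => //.
  exact: measurable_funD.
under eq_integral do rewrite /majorant EFinD EFinM muleC.
rewrite ge0_integralD//=; first last.
- exact/measurable_EFinP.
- by move=> z _; rewrite lee_fin mulr_ge0// expR_ge0.
- by apply: measurable_funeM; exact/measurable_EFinP.
- by move=> z _; rewrite mule_ge0// lee_fin ?invr_ge0 ?expR_ge0// ltW.
rewrite ge0_integralZl//=; first last.
- by rewrite lee_fin invr_ge0 ltW.
- exact/measurable_EFinP.
rewrite expectation_expRL EFinD -EFinM [X in _ <= X%:E + _]mulrC leeD2l//.
rewrite (le_trans _ integral_fp)//.
pose phi z := (fp (F z) * expR (- (L z - c)))%:E.
rewrite (eq_integral (fun z => phi (translate s z))); last first.
  by move=> z _; rewrite /phi L_translate; congr (_ * expR _)%:E; ring.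
rewrite cm; first last.
- by move=> z; rewrite lee_fin mulr_ge0// expR_ge0.
- exact/measurable_EFinP.
rewrite /phi.
rewrite le_eqVlt; apply/orP; left; apply/eqP; apply: eq_integral => z _.
by rewrite -EFinM mulrCA -expRD subrr expR0 mulr1.
Qed.

Theorem KL_gaussian_shift :
  KL P1 P2 <= ((\sum_k s k ^+ 2) / (2 * sigma ^+ 2))%:E.
Proof.
rewrite /KL; case: asboolP => [dom|/(_ shift_dominated)//]; rewrite -/f -/c.
have -> : \int[P1]_x lne (f x) = \int[Q]_z lne (f (F (translate s z))).
  rewrite -(integral_distribution_measurable Fs_rv (measurable_lne_comp mf f_fin)).
  by apply: eq_measure_integral => A mA _; exact: P1E.
have bound (la : R) : (0 < la)%R -> \int[Q]_z lne (f (F (translate s z))) <=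
    (expR (la ^+ 2 * c) / la + 1 + (c - 1 - la^-1))%:E.
  move=> la0; have iM : Q.-integrable setT (EFin \o majorant la).
    apply/integrableP; split; first exact/measurable_EFinP.
    rewrite (eq_integral (EFin \o majorant la)).
      exact: le_lt_trans (integral_majorant la0) (ltry _).
    by move=> z _; rewrite /= ger0_norm// majorant_ge0.
  have iK : Q.-integrable setT (EFin \o cst (c - 1 - la^-1)%R).
    exact: finite_measure_integrable_cst.
  apply: (@le_trans _ _ (\int[Q]_z ((EFin \o majorant la) z +
      (EFin \o cst (c - 1 - la^-1)%R) z))).
    apply: le_integral_integrable.
    - apply: (measurableT_comp (measurable_lne_comp mf f_fin)).
      exact: (measurableT_comp mF (measurable_translate s)).
    - exact: integrableD.
    - by move=> z; exact: lne_le_majorant.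
  rewrite integralD//= integral_cst//= probability_setT mule1 [leRHS]EFinD.
  by rewrite leeD2r// integral_majorant.
apply/lee_addgt0Pr => e e0.
(* The excess over [c] is [(expR (la ^+ 2 * c) - 1) / la], of order [la * c]. As [e / (e + 1)] is
   below both 1 and [e], this [la] keeps the exponent below 1/2 and [2 * (la * c)] below [e];
   [c + 1] allows [c = 0]. *)
pose la := (e / (e + 1) / (2 * (c + 1)))%R.
have c1 : (0 < c + 1)%R by rewrite ltr_wpDl.
have e1 : (0 < e + 1)%R by rewrite addr_gt0.
have la0 : (0 < la)%R by rewrite !divr_gt0// mulr_gt0.
apply: (le_trans (bound _ la0)); rewrite -EFinD lee_fin.
set x := (la ^+ 2 * c)%R.
have laE : (la * (2 * (c + 1)) = e / (e + 1))%R.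
  by rewrite /la divfK// gt_eqF// mulr_gt0.
have q1 : (e / (e + 1) <= 1)%R by rewrite ler_pdivrMr// mul1r lerDl.
have qe : (e / (e + 1) <= e)%R.
  by rewrite ler_pdivrMr// ler_peMr ?lerDr ?ltW.
have lac : (0 <= la * c)%R by rewrite mulr_ge0// ltW.
have x_le : (x <= 2^-1)%R.
  rewrite /x expr2 -mulrA; have : (la * (la * c) <= 2^-1 * 2^-1)%R.
    by apply: ler_pM; rewrite ?(ltW la0)//; lra.
  by move=> h; apply: (le_trans h); lra.
have x_ge : (0 <= x)%R by rewrite mulr_ge0// sqr_ge0.
(* From [1 - x <= expR (- x)], and [1 <= (1 + 2 * x) * (1 - x)] for [x] between 0 and 1/2. *)
have expx : (expR x <= 1 + 2 * x)%R.
  rewrite -(@ler_pM2r _ (1 - x)); last by lra.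
  have : (expR x * (1 - x) <= 1)%R.
    rewrite -[leRHS](expRxMexpNx_1 x) ler_pM2l ?expR_gt0//.
    by rewrite expR_ge1Dx.
  by move=> h; apply: (le_trans h); nra.
have : ((expR x - 1) / la <= 2 * (la * c))%R.
  rewrite ler_pdivrMr// /x in expx *; move: expx; rewrite expr2; lra.
by rewrite mulrBl mul1r; lra.
Qed.

End kl_gaussian_shift.

(** * The views of the protocol *)

Lemma k_connected_induced n (adj : rel 'I_n) (t : nat) (C : {set 'I_n}) :
  k_connected adj t.+1 -> (#|C| <= t)%N ->
  graph_connected (induced_subgraph adj (~: C)).
Proof.
move=> [_ cut] Ct; apply: contrapT => nconn.
by have := cut C nconn; rewrite ltnNge Ct.
Qed.

(** A cut of [t.+1] nodes leaves at least two, since a graph with at most one node is connected;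
    removing fewer nodes leaves even more. A single honest node would give a zero Laplacian, with no
    non-zero eigenvalue. *)
Lemma k_connected_card n (adj : rel 'I_n) (t : nat) (C : {set 'I_n}) :
  k_connected adj t.+1 -> (#|C| <= t)%N -> (1 < #|~: C|)%N.
Proof.
move=> [[S cutS St] _] Ct.
have S1 : (1 < #|~: S|)%N.
  rewrite ltnNge; apply/negP => S1; apply: cutS => x y.
  suff -> : x = y by rewrite eqxx.
  have zero (z : 'I_#|~: S|) : z = 0%N :> nat.
    by apply/eqP; rewrite -leqn0 -ltnS; exact: leq_trans (ltn_ord z) S1.
  by apply: val_inj; rewrite /= !zero.
have e : (#|C| + #|~: C| = t.+1 + #|~: S|)%N by rewrite -St !cardsC.
rewrite ltnNge; apply/negP => C1; have := leq_add Ct C1.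
rewrite e addSn addn1 ltnS -[leqRHS]addn0 leq_add2l leqn0 => /eqP S0.
by rewrite S0 in S1.
Qed.

Lemma dist_sqr (R : realType) n m (alpha alpha' : 'I_n -> m.-tuple R) :
  dist alpha alpha' ^+ 2 =
  \sum_(k < m) \sum_i (tnth (alpha i) k - tnth (alpha' i) k) ^+ 2.
Proof.
rewrite sqr_sqrtr; last by apply: sumr_ge0 => k _; exact: sqr_ge0.
apply: eq_bigr => k _; rewrite sqr_sqrtr.
  by apply: eq_bigr => i _; rewrite !mxE.
by apply: sumr_ge0 => i _; exact: sqr_ge0.
Qed.

(** * The draws as one Gaussian vector *)

Section flatten.
Context (R : realType) (d : measure_display) (Omega : measurableType d).
Context (P : probability Omega R) (n m : nat) (adj : rel 'I_n) (sigma : R).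
Variable r : 'I_n -> 'I_n -> {RV P >-> m.-tuple R}.

(** One index per scalar draw; non-adjacent pairs are left out because the law of [r] is
    unconstrained there. *)
Definition coordinates : {set 'I_n * 'I_n * 'I_m} :=
  [set q | adj q.1.1 q.1.2]%SET.

Local Notation N := #|coordinates|.

Definition draws_fun (w : Omega) : N.-tuple R :=
  [tuple tnth (r (enum_val l).1.1 (enum_val l).1.2 w) (enum_val l).2 | l < N].

Lemma measurable_draws : measurable_fun setT draws_fun.
Proof.
apply/measurable_fun_tnthP => l.
rewrite (_ : _ \o _ = fun w =>
    tnth (r (enum_val l).1.1 (enum_val l).1.2 w) (enum_val l).2); last first.
  by apply/funext => w /=; rewrite tnth_mktuple.
by apply: (measurableT_comp (measurable_tnth _)).
Qed.

HB.instance Definition _ :=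
  isMeasurableFun.Build _ _ _ _ draws_fun measurable_draws.

Definition draws : {RV P >-> N.-tuple R} := draws_fun.

Lemma draws_law (B : 'I_N -> set R) : protocol_draws adj sigma r ->
  (forall l, measurable (B l)) ->
  distribution P draws (box B) = (\prod_(l < N) normal_prob 0 sigma (B l))%E.
Proof.
move=> [gauss indep] mB.
(* The sides of the box, indexed by triples; the condition is vacuous, and the side full, outside
   [coordinates]. *)
pose b (q : 'I_n * 'I_n * 'I_m) : set R :=
  [set x | forall l : 'I_N, enum_val l = q -> B l x].
have bE l : b (enum_val l) = B l.
  by apply/seteqP; split => x /= => [/(_ l erefl)//|Blx k /enum_val_inj ->].
have mb q : measurable (b q).
  have [[l <-]|nl] := pselect (exists l : 'I_N, enum_val l = q).
    by rewrite bE.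
  rewrite (_ : b q = setT)//; apply/seteqP; split => // x _ l lq.
  by exfalso; apply: nl; exists l.
pose Bp (p : 'I_n * 'I_n) : set (m.-tuple R) :=
  [set x | forall k, b (p, k) (tnth x k)].
pose D : {set 'I_n * 'I_n} := [set p | adj p.1 p.2]%SET.
have mBp p : measurable (Bp p).
  by apply: (@measurable_box _ _ _ (fun k => b (p, k))) => k; exact: mb.
transitivity (P (\bigcap_(p in [set` D]) ((r p.1 p.2) @^-1` Bp p))).
  congr (P _); apply/seteqP; split => w /=.
    move=> Bw [i j]; rewrite /= inE /= => ij k.
    have qK : (i, j, k) \in coordinates by rewrite inE.
    move=> l lq; have := Bw l; rewrite tnth_mktuple lq //.
  move=> Bw l; rewrite tnth_mktuple -bE.
  have := enum_valP l; rewrite inE; case: (enum_val l) => [[i j] k] /= ij.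
  by apply: (Bw (i, j)); rewrite /= inE.
rewrite (indep D Bp)//.
transitivity (\prod_(p in D) \prod_(k < m) normal_prob 0 sigma (b (p, k)))%E.
  apply: eq_bigr => -[i j]; rewrite inE => ij.
  exact: (gauss i j ij (fun k => b ((i, j), k)) (fun k => mb _)).
rewrite pair_big_dep /=.
transitivity (\prod_(q in coordinates) normal_prob 0 sigma (b q))%E.
  by apply: eq_big => [[[i j] k]|[[i j] k] _] //; rewrite !inE andbT.
by rewrite big_enum_val; apply: eq_bigr => l _; rewrite bE.
Qed.

(** Two probability spaces are allowed in order to compare the draws on [Omega] with the coordinate
    projections on tuples. *)
Lemma view_fun_ext d' (Omega' : measurableType d') (P' : probability Omega' R)
    (r' : 'I_n -> 'I_n -> {RV P' >-> m.-tuple R})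
    (C : {set 'I_n}) alpha w w' : symmetric adj ->
  (forall i j, adj i j -> r i j w = r' i j w') ->
  view_fun adj r C alpha w = view_fun adj r' C alpha w'.
Proof.
move=> adjC rr'; congr (_, _, _).
  apply: eq_from_tnth => l; rewrite !tnth_mktuple; apply: rr'.
  by have := enum_valP l; rewrite inE => /andP[].
apply: eq_from_tnth => i; apply: eq_from_tnth => k; rewrite !tnth_mktuple.
congr (_ + _); apply: eq_bigr => j ij.
by rewrite (rr' i j ij) (rr' j i)// adjC.
Qed.

Variable Q : probability (N.-tuple R) R.

(* 0 when [i] and [j] are not adjacent. *)
Definition entry (i j : 'I_n) (k : 'I_m) (z : N.-tuple R) : R :=
  if [pick l : 'I_N | enum_val l == (i, j, k)] is Some l then tnth z l else 0.

Lemma measurable_entry i j k : measurable_fun setT (entry i j k).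
Proof. by rewrite /entry; case: pickP => // l _; exact: measurable_tnth. Qed.

Lemma entryE i j k l z : enum_val l = (i, j, k) -> entry i j k z = tnth z l.
Proof.
move=> lE; rewrite /entry; case: pickP => [l' /eqP|/(_ l)]; rewrite -?lE ?eqxx//.
by move=> /enum_val_inj ->.
Qed.

Lemma entry_translate (S : 'I_n -> 'I_n -> 'I_m -> R) i j k z : adj i j ->
  entry i j k (translate (fun l => S (enum_val l).1.1 (enum_val l).1.2 (enum_val l).2) z) =
  entry i j k z + S i j k.
Proof.
move=> ij; have qK : (i, j, k) \in coordinates by rewrite inE.
have lE := enum_rankK_in qK qK.
by rewrite !(entryE _ lE) tnth_mktuple lE.
Qed.

Definition entries_fun i j (z : N.-tuple R) : m.-tuple R :=
  [tuple entry i j k z | k < m].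

Lemma measurable_entries i j : measurable_fun setT (entries_fun i j).
Proof.
apply/measurable_fun_tnthP => k.
rewrite (_ : _ \o _ = entry i j k); first exact: measurable_entry.
by apply/funext => w /=; rewrite tnth_mktuple.
Qed.

HB.instance Definition _ i j :=
  isMeasurableFun.Build _ _ _ _ (entries_fun i j) (measurable_entries i j).

(** With the projections taken as draws, [view_fun] itself is the common map on tuples, and its
    measurability is [measurable_view]. *)
Definition entries i j : {RV Q >-> m.-tuple R} := entries_fun i j.

Lemma view_draws (C : {set 'I_n}) alpha w : symmetric adj ->
  view_fun adj r C alpha w = view_fun adj entries C alpha (draws w).
Proof.
move=> adjC; apply: view_fun_ext => // i j ij.
apply: eq_from_tnth => k; rewrite tnth_mktuple.
have qK : (i, j, k) \in coordinates by rewrite inE.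
have lE := enum_rankK_in qK qK.
by rewrite (entryE _ lE) tnth_mktuple lE.
Qed.

(** Draws seen by [C] do not move, and the net inflow of [S] at each node makes the mask absorb the
    change of coefficient. *)
Lemma view_translate (C : {set 'I_n}) alpha alpha' (S : 'I_n -> 'I_n -> 'I_m -> R) z :
  symmetric adj ->
  (forall i, i \in C -> alpha i = alpha' i) ->
  (forall i j k, (i \in C) || (j \in C) -> S i j k = 0) ->
  (forall i k, \sum_(j | adj i j) (S j i k - S i j k) =
     tnth (alpha i) k - tnth (alpha' i) k) ->
  view_fun adj entries C alpha z = view_fun adj entries C alpha'
    (translate (fun l => S (enum_val l).1.1 (enum_val l).1.2 (enum_val l).2) z).
Proof.
move=> adjC alphaC SC Ssum; congr (_, _, _).
- by apply: eq_from_tnth => l; rewrite !tnth_mktuple alphaC// enum_valP.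
- apply: eq_from_tnth => l; apply: eq_from_tnth => k; rewrite !tnth_mktuple.
  have := enum_valP l; rewrite inE => /andP[ij iC].
  by rewrite entry_translate// SC// addr0.
- apply: eq_from_tnth => i; apply: eq_from_tnth => k; rewrite !tnth_mktuple.
  set M := (X in _ + X); set M' := (X in _ = _ + X).
  suff -> : M' = M + (tnth (alpha i) k - tnth (alpha' i) k) by ring.
  rewrite -Ssum -big_split; apply: eq_bigr => j ij /=.
  by rewrite !tnth_mktuple !entry_translate// 1?adjC//; ring.
Qed.

End flatten.

Lemma protocol_affine_private (R : realType) (n m : nat) (sigma mu : R)
    (adj : rel 'I_n) (d : measure_display) (Omega : measurableType d)
    (P : probability Omega R) (r : 'I_n -> 'I_n -> {RV P >-> m.-tuple R})
    (C : {set 'I_n}) :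
  symmetric adj -> irreflexive adj -> 0 < sigma ->
  protocol_draws adj sigma r ->
  graph_connected (induced_subgraph adj (~: C)) -> 0 < mu ->
  (forall v : 'cV[R]_#|~: C|, \sum_i v i ord0 = 0 ->
    mu * \sum_i v i ord0 * v i ord0 <=
    \sum_i (laplacian R (induced_subgraph adj (~: C)) *m v) i ord0 * v i ord0) ->
  affine_private adj r C (1 / (4 * sigma ^+ 2 * mu)).
Proof.
move=> adjC adjxx sigma0 drawsP conn mu0 gap; split.
  by rewrite divr_gt0// !mulr_gt0// exprn_gt0.
move=> alpha alpha' alphaC alphaS.
pose delta k i := tnth (alpha i) k - tnth (alpha' i) k.
have /choice[U UP] k : exists U : 'I_n -> R,
    (forall i, i \in ~: C ->
       \sum_(j in ~: C | adj i j) (U i - U j) = delta k i) /\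
    \sum_(i in ~: C) \sum_(j in ~: C | adj i j) (U i - U j) ^+ 2 <=
      2 * (\sum_(i in ~: C) delta k i ^+ 2) / mu.
  apply: induced_potential => //.
  by rewrite sumrB alphaS subrr.
(* Only [S j i k - S i j k] affects the masks; splitting it evenly between the two directions
   minimizes the sum of squares. *)
pose S i j k : R := if (i \in ~: C) && (j \in ~: C) then (U k j - U k i) / 2 else 0.
have SC i j k : (i \in C) || (j \in C) -> S i j k = 0.
  by rewrite /S !inE -negb_or => ->.
have Ssum i k : \sum_(j | adj i j) (S j i k - S i j k) = delta k i.
  have [iC|iC] := boolP (i \in C).
    rewrite /delta alphaC// subrr big1// => j _.
    by rewrite !SC ?iC ?orbT// subrr.
  rewrite -(UP k).1 ?inE// big_mkcondl; apply: eq_bigr => j ij.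
  rewrite /S !inE iC andbT /=; case: ifP => _; last by rewrite subrr.
  by field.
pose Q := distribution P (draws adj r).
pose s (l : 'I_#|coordinates m adj|) :=
  S (enum_val l).1.1 (enum_val l).1.2 (enum_val l).2.
have Qbox B : (forall l, measurable (B l)) ->
    Q (box B) = (\prod_(l < #|coordinates m adj|) normal_prob 0 sigma (B l))%E.
  exact: draws_law.
pose F := view_fun adj (@entries R n m adj Q) C alpha'.
have mF : measurable_fun setT F by exact: measurable_view.
have law1 A : measurable A ->
    distribution P (view adj r C alpha) A = Q [set z | A (F (translate s z))].
  move=> mA; congr (P _); apply/seteqP; split => w /=;
    by rewrite /view /= (view_draws _ Q) // (view_translate _ _ adjC alphaC SC Ssum).
have law2 A : measurable A ->
    distribution P (view adj r C alpha') A = Q [set z | A (F z)].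
  move=> mA; congr (P _); apply/seteqP; split => w /=;
    by rewrite /view /= (view_draws _ Q).
apply: (le_trans (KL_gaussian_shift sigma0 Qbox mF law1 law2)).
rewrite lee_fin dist_sqr.
have sumS : \sum_l s l ^+ 2 = 4^-1 * \sum_k
    \sum_(i in ~: C) \sum_(j in ~: C | adj i j) (U k i - U k j) ^+ 2.
  transitivity (\sum_(q in coordinates m adj) S q.1.1 q.1.2 q.2 ^+ 2).
    by rewrite [RHS]big_enum_val.
  transitivity (\sum_i \sum_(j | adj i j) \sum_k S i j k ^+ 2).
    rewrite pair_big_dep pair_big /=.
    by apply: eq_big => [[[i j] k]|[[i j] k] _//]; rewrite !inE/= andbT.
  under eq_bigr do rewrite exchange_big /=.
  rewrite exchange_big /= mulr_sumr; apply: eq_bigr => k _.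
  rewrite mulr_sumr [RHS]big_mkcond; apply: eq_bigr => i _.
  case: ifP => iC; last by rewrite big1// => j _; rewrite /S iC expr0n.
  rewrite mulr_sumr [RHS]big_mkcondl; apply: eq_bigr => j _.
  rewrite /S iC /=; case: ifP => jC; last by rewrite expr0n.
  by field.
rewrite sumS.
have le : \sum_k \sum_(i in ~: C) \sum_(j in ~: C | adj i j) (U k i - U k j) ^+ 2
    <= 2 / mu * \sum_k \sum_i delta k i ^+ 2.
  rewrite mulr_sumr; apply: ler_sum => k _; apply: (le_trans (UP k).2).
  rewrite mulrAC ler_pM2l ?divr_gt0//.
  by rewrite [leRHS](bigID (mem (~: C)))/= lerDl sumr_ge0// => i _; exact: sqr_ge0.
(* The constant collects 1/4 from the squared halves, 2 from edges counted in both directions, and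
   [1 / (2 * sigma ^+ 2)] from the Gaussian divergence. *)
have s2 : 0 < sigma ^+ 2 by rewrite exprn_gt0.
rewrite ler_pdivrMr ?mulr_gt0//.
rewrite (_ : _ * (2 * sigma ^+ 2) =
  4^-1 * (2 / mu * \sum_k \sum_i delta k i ^+ 2)); first by rewrite ler_pM2l.
by rewrite /delta; field; rewrite !gt_eqF.
Qed.

Theorem corollary1 (R : realType) (n m t : nat) (sigma : R)
    (adj : rel 'I_n)
    (d : measure_display) (Omega : measurableType d)
    (P : probability Omega R)
    (r : 'I_n -> 'I_n -> {RV P >-> m.-tuple R}) :
  symmetric adj -> irreflexive adj ->
  graph_connected adj ->
  (1 <= m)%N -> 0 < sigma ->
  protocol_draws adj sigma r ->
  k_connected adj t.+1 ->
  forall C : {set 'I_n}, (#|C| <= t)%N ->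
  exists mu : R,
    smallest_nonzero_eigenvalue
      (laplacian R (induced_subgraph adj (~: C))) mu /\
    affine_private adj r C (1 / (4 * sigma ^+ 2 * mu)).
Proof.
move=> adjC adjxx _ _ sigma0 drawsP kconn C Ct.
have conn := k_connected_induced kconn Ct.
have [mu [mu_min mu0 gap]] : exists mu : R, [/\
    smallest_nonzero_eigenvalue (laplacian R (induced_subgraph adj (~: C))) mu, 0 < mu &
    forall v : 'cV[R]_#|~: C|, \sum_i v i ord0 = 0 ->
    mu * \sum_i v i ord0 * v i ord0 <=
    \sum_i (laplacian R (induced_subgraph adj (~: C)) *m v) i ord0 * v i ord0].
  apply: laplacian_spectral_gap => //; last exact: k_connected_card kconn Ct.
  - by move=> a b; exact: adjC.
  - by move=> a; exact: adjxx.
exists mu; split => //; exact: protocol_affine_private.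
Qed.
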